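(* The operator $\mathcal{K}$ is bounded self-adjoint in $L_2(\pi)$. The least point $\gamma=\min S$ of its spectrum $S$ (the support of the spectral measure $\psi$, corresponding to eigenvalues $-x$ of $\mathcal{K}$ for $x\in S$) is such that $0<\gamma\le\beta$. The solution $z_t=e^{\mathcal{K}t}z_0$ in $L_2(\pi)$ of $\dot z_t=\mathcal{K}z_t$, $t\ge0$, satisfies $$\|z_t\|_{L_2(\pi)}\le e^{-\gamma t}\|z_0\|_{L_2(\pi)},\qquad t\ge0.$$
   Context: $\alpha,\beta>0$ with $\rho=\alpha/\beta<1$, $L\ge1$ an integer. $\pi(k)=L^{k-1}\rho^{L+L^2+\cdots+L^{k-1}}=L^{k-1}\rho^{(L^k-L)/(L-1)}$, $k\ge1$ (read as $\rho^{k-1}$ if $L=1$). $L_2(\pi)$ is the Hilbert space of real sequences $x=(x(k))_{k\ge0}$ with $x(0)=0$ and $\|x\|_{L_2(\pi)}^2=\sum_{k\ge1}x(k)^2\pi(k)^{-1}<\infty$. $\mathcal{K}x(k)=\beta L\rho^{L^{k-1}}x(k-1)-(\beta L\rho^{L^k}+\beta)x(k)+\beta x(k+1)$, $k\ge1$ (with $x(0)=0$). Spectrum: let $Q_n$, $n\ge1$, be the polynomials ($\deg Q_n=n-1$) defined by $Q_0=0$, $Q_1=1$ and $-xQ_n(x)=\beta Q_{n-1}(x)-(\beta L\rho^{L^n}+\beta)Q_n(x)+\beta L\rho^{L^n}Q_{n+1}(x)$, $n\ge1$. The spectral measure $\psi$ is the probability measure on $\mathbb{R}_+$ with respect to which they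 are orthogonal: $\int_0^\infty Q_i(x)^2\,\psi(dx)=\pi(i)^{-1}$, $\int_0^\infty Q_i(x)Q_j(x)\,\psi(dx)=0$ for $i\ne j$. Its support $S$ is called the spectrum; it is the spectrum of $-\mathcal{K}$ in $L_2(\pi)$ in the usual operator sense. *)

(* Defs.v *)
From HB Require Import structures.
From mathcomp Require Import all_boot all_order all_algebra.
From mathcomp Require Import all_classical all_reals all_analysis.
From mathcomp Require Import ring.
Set Implicit Arguments.
Unset Strict Implicit.
Unset Printing Implicit Defensive.
Import Order.TTheory GRing.Theory Num.Theory.
Import numFieldNormedType.Exports.
Local Open Scope classical_set_scope.
Local Open Scope ring_scope.

(* The exponent L + L^2 + ... + L^(k-1) is kept as a sum, which also gives
   rho^(k-1) when L = 1.  Only the values at k >= 1 are meaningful. *)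
Definition weight (R : realType) (rho : R) (L k : nat) : R :=
  L%:R ^+ k.-1 * rho ^+ (\sum_(1 <= j < k) L ^ j)%N.

(* ** The Hilbert space of sequences (x(k)), k >= 0, with x(0) = 0, for a
   weight w on the indices k >= 1 (series are shifted by one). *)

Definition L2 (R : realType) (w : nat -> R) (x : nat -> R) : Prop :=
  x 0%N = 0 /\ cvgn (series (fun k => x k.+1 ^+ 2 / w k.+1)).

Definition L2dot (R : realType) (w : nat -> R) (x y : nat -> R) : R :=
  limn (series (fun k => x k.+1 * y k.+1 / w k.+1)).

Definition L2norm (R : realType) (w : nat -> R) (x : nat -> R) : R :=
  Num.sqrt (limn (series (fun k => x k.+1 ^+ 2 / w k.+1))).

Definition bounded_op (R : realType) (w : nat -> R)
    (T : (nat -> R) -> nat -> R) : Prop :=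
  [/\ forall x, L2 w x -> L2 w (T x),
      forall a x y, L2 w x -> L2 w y -> T (a *: x + y) = a *: T x + T y
    & exists M : R, forall x, L2 w x -> L2norm w (T x) <= M * L2norm w x].

(* To be used for everywhere defined (bounded) operators only. *)
Definition selfadjoint_op (R : realType) (w : nat -> R)
    (T : (nat -> R) -> nat -> R) : Prop :=
  forall x y, L2 w x -> L2 w y -> L2dot w (T x) y = L2dot w x (T y).

(* z' = T z on [0, +oo[, the derivative (one-sided at 0) being taken in the
   norm of L2 w. *)
Definition solves_ode (R : realType) (w : nat -> R)
    (T : (nat -> R) -> nat -> R) (z : R -> nat -> R) : Prop :=
  (forall t, 0 <= t -> L2 w (z t)) /\
  (forall t, 0 <= t ->
    (fun s => L2norm w ((s - t)^-1 *: (z s - z t) - T (z t)))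
      @ within `[0, +oo[ t^' --> (0 : R)).

(* y = e^(t T) z0, as the sum of the exponential series in the norm of L2 w. *)
Definition is_expop (R : realType) (w : nat -> R)
    (T : (nat -> R) -> nat -> R) (t : R) (z0 y : nat -> R) : Prop :=
  L2 w y /\
  (fun N => L2norm w (y - \sum_(n < N) (t ^+ n / n`!%:R) *: iter n T z0))
    @ \oo --> (0 : R).

(* The value at 0 makes the operator act on sequences vanishing at 0. *)
Definition opK (R : realType) (beta rho : R) (L : nat) (x : nat -> R) :
    nat -> R := fun k =>
  if k is j.+1 then
    beta * L%:R * rho ^+ (L ^ j)%N * x j
    - (beta * L%:R * rho ^+ (L ^ j.+1)%N + beta) * x j.+1
    + beta * x j.+2
  else 0.

(* The recurrence of lemma polQ_rec, solved for its last term. *)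
Fixpoint polQ (R : realType) (beta rho : R) (L n : nat) : {poly R} :=
  match n with
  | 0 => 0
  | m.+1 =>
    match m with
    | 0 => 1
    | p.+1 =>
      (beta * L%:R * rho ^+ (L ^ m)%N)^-1 *:
        ((beta * L%:R * rho ^+ (L ^ m)%N + beta)%:P * polQ beta rho L m
         - 'X * polQ beta rho L m - beta *: polQ beta rho L p)
    end
  end.

Lemma polQ_rec (R : realType) (beta rho : R) (L n : nat) (x : R) :
  0 < beta -> 0 < rho -> (0 < L)%N -> (0 < n)%N ->
  - x * (polQ beta rho L n).[x] =
    beta * (polQ beta rho L n.-1).[x]
    - (beta * L%:R * rho ^+ (L ^ n)%N + beta) * (polQ beta rho L n).[x]
    + beta * L%:R * rho ^+ (L ^ n)%N * (polQ beta rho L n.+1).[x].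
Proof.
move=> b0 r0 L0; case: n => [//|n] _.
have c0 : beta * L%:R * rho ^+ (L ^ n.+1)%N != 0.
  by rewrite lt0r_neq0// !mulr_gt0// ?ltr0n// exprn_gt0.
rewrite [polQ _ _ _ n.+2]/= -/(polQ beta rho L n.+1) [n.+1.-1]/=.
rewrite hornerZ mulrA divff// mul1r 2!hornerD !hornerN hornerM hornerC hornerM.
by rewrite hornerX hornerZ; move: (_ * rho ^+ _) => c; ring.
Qed.

Definition spectral_measure (R : realType) (beta rho : R) (L : nat)
    (psi : probability (measurableTypeR R) R) : Prop :=
  [/\ psi `[0%R, +oo[%classic = 1%E,
      forall i, (0 < i)%N ->
        (\int[psi]_(x in `[0%R, +oo[) ((polQ beta rho L i).[x] ^+ 2)%:E)%E
        = ((weight rho L i)^-1)%:E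
    & forall i j, (0 < i)%N -> (0 < j)%N -> i != j ->
        (\int[psi]_(x in `[0%R, +oo[)
           ((polQ beta rho L i).[x] * (polQ beta rho L j).[x])%:E)%E
        = 0%E].

Definition measure_support (R : realType)
    (mu : set (measurableTypeR R) -> \bar R) : set R :=
  [set x | forall U : set R, open U -> U x -> (0 < mu U)%E].

Definition is_least (R : realType) (S : set R) (m : R) : Prop :=
  S m /\ forall x, S x -> m <= x.

(* Main.v *)
Require Import Defs.
From HB Require Import structures.
From mathcomp Require Import all_boot all_order all_algebra.
From mathcomp Require Import all_classical all_reals all_analysis.
From mathcomp Require Import measurable_realfun ring lra.
Import Order.TTheory GRing.Theory Num.Theory.
Import numFieldNormedType.Exports.
Local Open Scope classical_set_scope.
Local Open Scope ring_scope.
Set Implicit Arguments.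
Unset Strict Implicit.

(** Write [b_k = beta L rho^(L^k)].  The operator is the Jacobi operator
    [(K x)(k) = b_(k-1) x(k-1) - (b_k + beta) x(k) + beta x(k+1)], and the
    weight satisfies [beta pi(k+1) = b_k pi(k)], which makes [K] symmetric:
    the partial sums of [<K x, y> - <x, K y>] telescope to one boundary term,
    and this term vanishes along square-summable sequences ([green],
    [boundary_cvg0]).

    Boundedness and the spectral gap both come from one Schur test.  For [M]
    at least [b_k + beta], the matrix of [M + K] has nonnegative entries, so a
    positive [h] with [(M + K) h <= theta h] yields [||M + K|| <= theta]
    ([schur_le]).  Such an [h] exists with [theta = M - delta], [delta > 0]
    ([supersolution]): [h = pi] gives [theta = M], and since [b_k] is
    eventually at most a fixed fraction of [beta], there is room to let [h] decay
    slightly more slowly than [pi].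

    The flow is the exponential series, summed coordinatewise and controlled
    in norm by a numerical majorant ([orbit_series_le]).  Along any solution
    the energy [||z||^2] has derivative [2 <K z, z>]; the Gronwall lemma then
    gives uniqueness, from the boundedness of [K], and the decay rate, from
    [<K x, x> <= - gamma ||x||^2].

    The spectral measure enters through the map sending [x] to the function
    [sum_k x(k) Q_k], which is an isometry into [L^2(psi)] and turns [- K]
    into the multiplication by the variable [u], up to a boundary term
    ([expand_integral], [expand_mulX]).  Hence if [psi] has no mass below [t],
    then [<- K x, x> >= t ||x||^2] ([form_lower_bound]); the least point
    [gamma] of the support is the supremum of these [t]
    ([exists_spectral_bottom]).
    - [gamma <= beta]: take [x = pi], for which [K x] lives on the first site
      ([null_ray_le_beta]).
    - [gamma > 0]: the function [(M - u)^n] is the image of [(M + K)^n e_1], so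
      the integral of [(M - u)^(2n)] is at most [theta^(2n) / pi(1)]; letting
      [n] grow, [psi] has no mass where [M - u > theta], that is below [delta]
      ([null_ray]). *)

Ltac nonneg := repeat first [exact: sqr_ge0 | assumption | exact: ltW
  | apply: addr_ge0 | apply: mulr_ge0 | apply: divr_ge0 | rewrite invr_ge0].

(** * The weighted space of square-summable sequences *)

Section WeightedL2.
Context (R : realType) (w : nat -> R) (w_gt0 : forall k, 0 < w k.+1).
Implicit Types (x y z : nat -> R) (a : R) (n : nat).

Lemma seqDE x y k : (x + y) k = x k + y k. Proof. by []. Qed.

Lemma seqZE a x k : (a *: x) k = a * x k. Proof. by []. Qed.

(** Partial sums of the inner product.  The identities behind the operator
    are exact on partial sums, up to boundary terms, before any limit. *)
Definition pdot x y : R^nat := series (fun k => x k.+1 * y k.+1 / w k.+1).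

Lemma pdotS x y n : pdot x y n.+1 = pdot x y n + x n.+1 * y n.+1 / w n.+1.
Proof. by rewrite /pdot /series/= big_nat_recr. Qed.

Lemma pdot0 x y : pdot x y 0 = 0.
Proof. by rewrite /pdot /series/= big_geq. Qed.

Lemma pdotC x y : pdot x y = pdot y x.
Proof. by apply/funext => n; apply: eq_bigr => k _; rewrite (mulrC (x _)). Qed.

Lemma pdotDl x y z n : pdot (x + y) z n = pdot x z n + pdot y z n.
Proof.
elim: n => [|n IH]; first by rewrite !pdot0 addr0.
by rewrite !pdotS IH seqDE !mulrDl addrACA.
Qed.

Lemma pdotZl a x z n : pdot (a *: x) z n = a * pdot x z n.
Proof.
elim: n => [|n IH]; first by rewrite !pdot0 mulr0.
by rewrite !pdotS IH seqZE mulrDr !mulrA.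
Qed.

Lemma pdotDr x y z n : pdot z (x + y) n = pdot z x n + pdot z y n.
Proof. by rewrite pdotC pdotDl !(pdotC _ z). Qed.

Lemma pdotZr a x z n : pdot z (a *: x) n = a * pdot z x n.
Proof. by rewrite pdotC pdotZl pdotC. Qed.

Lemma pdotxx_term_ge0 x k : 0 <= x k.+1 * x k.+1 / w k.+1.
Proof. by rewrite divr_ge0 ?(ltW (w_gt0 k))// -expr2 sqr_ge0. Qed.

Lemma pdotxx_ge0 x n : 0 <= pdot x x n.
Proof. by apply: sumr_ge0 => k _; exact: pdotxx_term_ge0. Qed.

Lemma pdotxx_homo x : {homo pdot x x : m n / (m <= n)%N >-> m <= n}.
Proof.
apply/nondecreasing_seqP => n.
by rewrite pdotS lerDl; exact: pdotxx_term_ge0.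
Qed.

(** The series has nonnegative terms, so a bound on its partial sums yields
    both convergence and the bound on the norm: membership and norm estimates
    are obtained together. *)
Lemma L2_le x a : x 0%N = 0 -> 0 <= a -> (forall n, pdot x x n <= a ^+ 2) ->
  L2 w x /\ L2norm w x <= a.
Proof.
move=> x0 a0 xa.
have cx : cvgn (pdot x x).
  apply: nondecreasing_is_cvgn; first exact: pdotxx_homo.
  by exists (a ^+ 2) => _ [n _ <-].
split; first by split.
rewrite -(ger0_norm a0) -sqrtr_sqr /L2norm ler_wsqrtr//.
by apply: limr_le => //; near=> n; exact: xa.
Unshelve. all: by end_near. Qed.

Lemma L2norm_ge0 x : 0 <= L2norm w x.
Proof. exact: sqrtr_ge0. Qed.

Lemma sqr_L2norm x : L2 w x -> L2norm w x ^+ 2 = limn (pdot x x).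
Proof.
move=> [_ cx]; rewrite sqr_sqrtr//.
apply: limr_ge => //; near=> n; exact: pdotxx_ge0.
Unshelve. all: by end_near. Qed.

Lemma pdot_le x n : L2 w x -> pdot x x n <= L2norm w x ^+ 2.
Proof.
move=> Lx; rewrite sqr_L2norm//; apply: nondecreasing_cvgn_le.
  exact: pdotxx_homo.
by case: Lx.
Qed.

Lemma L2D x y : L2 w x -> L2 w y -> L2 w (x + y).
Proof.
move=> Lx Ly.
apply: (L2_le (a := L2norm w x + L2norm w x + L2norm w y + L2norm w y) _ _ _).1.
- by case: Lx Ly => x0 _ [y0 _]; rewrite seqDE x0 y0 addr0.
- by rewrite !addr_ge0 ?L2norm_ge0.
move=> n; have := pdot_le n Lx; have := pdot_le n Ly.
have : pdot (x + y) (x + y) n <= 2 * pdot x x n + 2 * pdot y y n.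
  elim: n => [|n IH]; first by rewrite !pdot0; lra.
  rewrite !pdotS.
  have : (x + y) n.+1 * (x + y) n.+1 / w n.+1 <=
    2 * (x n.+1 * x n.+1 / w n.+1) + 2 * (y n.+1 * y n.+1 / w n.+1).
    rewrite seqDE !mulrA -mulrDl.
    rewrite ler_wpM2r ?invr_ge0 ?(ltW (w_gt0 n))//.
    have := sqr_ge0 (x n.+1 - y n.+1); nra.
  lra.
have := L2norm_ge0 x; have := L2norm_ge0 y.
move: (L2norm w x) (L2norm w y) => u v; nra.
Qed.

Lemma L2Z a x : L2 w x -> L2 w (a *: x).
Proof.
move=> Lx; apply: (L2_le (a := `|a| * L2norm w x) _ _ _).1.
- by case: Lx => x0 _; rewrite seqZE x0 mulr0.
- by rewrite mulr_ge0 ?L2norm_ge0.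
move=> n; rewrite pdotZl pdotZr mulrA -expr2 exprMn real_normK ?num_real//.
by rewrite ler_wpM2l ?sqr_ge0// pdot_le.
Qed.

Lemma L2B x y : L2 w x -> L2 w y -> L2 w (x - y).
Proof. by move=> Lx Ly; rewrite -scaleN1r; apply: L2D => //; apply: L2Z. Qed.

Lemma L20 : L2 w 0.
Proof.
apply: (L2_le (a := 0) _ _ _).1 => // n; rewrite /pdot /series/= big1 ?expr0n//.
by move=> k _; rewrite !mul0r.
Qed.

Lemma L2_sum (I : Type) (s : seq I) (F : I -> nat -> R) :
  (forall i, L2 w (F i)) -> L2 w (\sum_(i <- s) F i).
Proof. by move=> LF; elim/big_ind: _ => //; [exact: L20 | exact: L2D]. Qed.

Lemma cvg_pdot x y : L2 w x -> L2 w y -> pdot x y @ \oo --> L2dot w x y.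
Proof.
move=> Lx Ly; suff : cvgn (pdot x y) by [].
(* Polarization reduces the mixed series to three series of squares. *)
have -> : pdot x y = (fun n => 2^-1 *
    (pdot (x + y) (x + y) n - pdot x x n - pdot y y n)).
  apply/funext => n; rewrite pdotDl !pdotDr (pdotC y x); by field.
apply: is_cvgMl_tmp; apply: is_cvgB; first apply: is_cvgB.
- by case: (L2D Lx Ly).
- by case: Lx.
- by case: Ly.
Qed.

Lemma L2dotxx x : L2 w x -> L2dot w x x = L2norm w x ^+ 2.
Proof. by move=> Lx; rewrite sqr_L2norm. Qed.

Lemma L2dotC x y : L2dot w x y = L2dot w y x.
Proof. by rewrite /L2dot -![series _]/(pdot _ _) pdotC. Qed.

Lemma L2dotDl x y z : L2 w x -> L2 w y -> L2 w z ->
  L2dot w (x + y) z = L2dot w x z + L2dot w y z.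
Proof.
move=> Lx Ly Lz; apply: cvg_lim => //.
rewrite -[series _]/(pdot _ _).
have -> : pdot (x + y) z = pdot x z \+ pdot y z by apply/funext => n; exact: pdotDl.
by apply: cvgD; exact: cvg_pdot.
Qed.

Lemma L2dotZl a x z : L2 w x -> L2 w z -> L2dot w (a *: x) z = a * L2dot w x z.
Proof.
move=> Lx Lz; apply: cvg_lim => //.
rewrite -[series _]/(pdot _ _).
have -> : pdot (a *: x) z = (fun n => a * pdot x z n).
  by apply/funext => n; exact: pdotZl.
by apply: cvgMl_tmp; exact: cvg_pdot.
Qed.

Lemma L2dotDr x y z : L2 w x -> L2 w y -> L2 w z ->
  L2dot w z (x + y) = L2dot w z x + L2dot w z y.
Proof. by move=> *; rewrite L2dotC L2dotDl// !(L2dotC z). Qed.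

Lemma L2dotZr a x z : L2 w x -> L2 w z -> L2dot w z (a *: x) = a * L2dot w z x.
Proof. by move=> *; rewrite L2dotC L2dotZl// (L2dotC z). Qed.

Lemma L2norm0_eq0 x : L2 w x -> L2norm w x = 0 -> x = 0.
Proof.
move=> Lx x0; apply/funext => -[|k]; first by case: Lx.
have := pdot_le k.+1 Lx; rewrite x0 expr0n/= pdotS => xk.
have := pdotxx_ge0 x k; have := pdotxx_term_ge0 x k => k0 n0.
have : x k.+1 * x k.+1 / w k.+1 = 0 by lra.
move/eqP; rewrite mulf_eq0 invr_eq0 (gt_eqF (w_gt0 k)) orbF -expr2 expf_eq0/=.
by move/eqP.
Qed.

Lemma L2norm0 : L2norm w 0 = 0.
Proof.
apply/eqP; rewrite eq_le L2norm_ge0 andbT.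
apply: (L2_le (x := 0) _ _ _).2 => // n; rewrite /pdot /series/= big1 ?expr0n//.
by move=> k _; rewrite !mul0r.
Qed.

Lemma L2dot0l x : L2dot w 0 x = 0.
Proof.
rewrite /L2dot -[series _]/(pdot _ _).
rewrite (_ : pdot 0 x = fun=> 0) ?lim_cst//.
by apply/funext => n; rewrite /pdot /series/= big1// => k _; rewrite !mul0r.
Qed.

Lemma L2norm_sqrD x y : L2 w x -> L2 w y ->
  L2norm w (x + y) ^+ 2 = L2norm w x ^+ 2 + 2 * L2dot w x y + L2norm w y ^+ 2.
Proof.
move=> Lx Ly; have Lxy := L2D Lx Ly.
by rewrite -!L2dotxx// L2dotDl// !L2dotDr// (L2dotC y x); ring.
Qed.

Lemma L2normZ a x : L2 w x -> L2norm w (a *: x) = `|a| * L2norm w x.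
Proof.
move=> Lx; have Lax := L2Z a Lx.
apply/eqP; rewrite -(@eqrXn2 _ 2)// ?mulr_ge0 ?L2norm_ge0//.
rewrite -L2dotxx// L2dotZl// L2dotZr// L2dotxx//.
by rewrite exprMn real_normK ?num_real// mulrA.
Qed.

Lemma CauchySchwarz x y : L2 w x -> L2 w y ->
  L2dot w x y <= L2norm w x * L2norm w y.
Proof.
move=> Lx Ly.
have [x0|x0] := eqVneq (L2norm w x) 0.
  by rewrite (L2norm0_eq0 Lx x0) L2dot0l L2norm0 mul0r.
have [y0|y0] := eqVneq (L2norm w y) 0.
  by rewrite (L2norm0_eq0 Ly y0) L2dotC L2dot0l L2norm0 mulr0.
(* The square of the norm of [v x - u y], where [u], [v] are the norms of [x]
   and [y], is twice [u v (u v - <x, y>)]. *)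
set u := L2norm w x; set v := L2norm w y.
have u0 : 0 < u by rewrite lt_def x0 L2norm_ge0.
have v0 : 0 < v by rewrite lt_def y0 L2norm_ge0.
have := sqr_ge0 (L2norm w (v *: x + (- u) *: y)).
rewrite L2norm_sqrD; [|exact: L2Z..].
rewrite !L2normZ// L2dotZl//; last exact: L2Z.
rewrite L2dotZr// normrN !gtr0_norm// -/u -/v.
move: (L2dot w x y) => d H.
have : 0 <= (2 * (u * v)) * (u * v - d).
  by rewrite [X in _ <= X](_ : _ =
    (v * u) ^+ 2 + 2 * (v * (- u * d)) + (u * v) ^+ 2)//; ring.
by rewrite pmulr_rge0 ?subr_ge0// !mulr_gt0.
Qed.

Lemma CauchySchwarz_abs x y : L2 w x -> L2 w y ->
  `|L2dot w x y| <= L2norm w x * L2norm w y.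
Proof.
move=> Lx Ly; rewrite ler_norml CauchySchwarz// andbT lerNl.
rewrite -[X in X <= _]mulN1r -L2dotZl//.
by rewrite (le_trans (CauchySchwarz (L2Z _ Lx) Ly))// L2normZ// normrN1 mul1r.
Qed.

Lemma L2norm_triangle x y : L2 w x -> L2 w y ->
  L2norm w (x + y) <= L2norm w x + L2norm w y.
Proof.
move=> Lx Ly.
rewrite -(@ler_sqr _ (L2norm w (x + y))) ?nnegrE ?addr_ge0 ?L2norm_ge0//.
rewrite L2norm_sqrD// sqrrD; have := CauchySchwarz Lx Ly; lra.
Qed.

Lemma L2norm_sum (I : Type) (s : seq I) (F : I -> nat -> R) :
  (forall i, L2 w (F i)) ->
  L2norm w (\sum_(i <- s) F i) <= \sum_(i <- s) L2norm w (F i).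
Proof.
move=> LF; elim: s => [|i s IH]; first by rewrite !big_nil L2norm0.
rewrite !big_cons; apply: le_trans (L2norm_triangle _ _) _ => //.
  exact: L2_sum.
by rewrite lerD2l.
Qed.

Lemma L2_coord x k : L2 w x -> `|x k| <= Num.sqrt (w k) * L2norm w x.
Proof.
move=> Lx; case: k => [|k].
  by case: Lx => -> _; rewrite normr0 mulr_ge0 ?sqrtr_ge0.
rewrite -ler_sqr ?nnegrE ?mulr_ge0 ?sqrtr_ge0// exprMn sqr_sqrtr ?(ltW (w_gt0 k))//.
rewrite real_normK ?num_real// mulrC -ler_pdivrMr//.
apply: le_trans (pdot_le k.+1 Lx); rewrite pdotS expr2.
by rewrite lerDr pdotxx_ge0.
Qed.

End WeightedL2.

(** * Jacobi operators symmetric for a weight *)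

Section BirthDeath.
Context (R : realType) (w : nat -> R) (w_gt0 : forall k, 0 < w k.+1).
Context (beta C : R) (b : nat -> R).
Context (beta_gt0 : 0 < beta) (b_gt0 : forall k, 0 < b k).
Context (b_le : forall k, b k <= C).
Context (wS : forall k, beta * w k.+2 = b k.+1 * w k.+1).
Implicit Types x y : nat -> R.

Definition jacobi x : nat -> R := fun k =>
  if k is j.+1 then b j * x j - (b j.+1 + beta) * x j.+1 + beta * x j.+2
  else 0.

Lemma jacobi_linear a x y : jacobi (a *: x + y) = a *: jacobi x + jacobi y.
Proof.
apply/funext => -[|k]; rewrite seqDE seqZE /= ?seqDE ?seqZE; first by ring.
ring.
Qed.

(** Symmetry of the edge weights; the common value is the conductance of the
    edge between [k+1] and [k+2].  The form [b k / w k.+1] also makes sense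
    for the edge between [0] and [1], where [w 0] has no meaning. *)
Lemma edge_weight k : b k.+1 / w k.+2 = beta / w k.+1.
Proof.
have := wS k; have /gt_eqF := w_gt0 k; have /gt_eqF := w_gt0 k.+1.
move=> w2 w1 e; apply/eqP; rewrite eqr_div ?w1 ?w2//; by rewrite e.
Qed.

Section Schur.
Context (h : nat -> R) (M theta : R).
Context (h_gt0 : forall k, 0 < h k) (M_ge : forall k, b k.+1 + beta <= M).
Context (h_super : forall k,
  b k * h k + (M - (b k.+1 + beta)) * h k.+1 + beta * h k.+2 <= theta * h k.+1).

Lemma supersolution_rate_gt0 : 0 < theta.
Proof.
rewrite -(pmulr_lgt0 _ (h_gt0 1)); apply: lt_le_trans (h_super 0).
rewrite -addrA ltr_wpDr ?mulr_gt0// addr_ge0// mulr_ge0 ?subr_ge0 ?(ltW (h_gt0 _))//.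
exact: ltW.
Qed.

(** Cauchy-Schwarz for three nonnegative masses. *)
Lemma weighted_square_le (p q r u v z : R) : 0 <= p -> 0 <= q -> 0 <= r ->
  (p * u + q * v + r * z) ^+ 2 <=
  (p + q + r) * (p * u ^+ 2 + q * v ^+ 2 + r * z ^+ 2).
Proof.
move=> p0 q0 r0; rewrite -subr_ge0.
rewrite [X in 0 <= X](_ : _ = p * q * (u - v) ^+ 2 + p * r * (u - z) ^+ 2
    + q * r * (v - z) ^+ 2).
  by nonneg.
ring.
Qed.

(** Schur test in local form.  By Cauchy-Schwarz and [h_super] the [k]th term
    on the left is at most [theta h_k / w_k] times the action of the matrix on
    [(x / h)^2]; moving the matrix onto [h] by symmetry costs a discrete
    flux, which telescopes and leaves the term on the edge [(n, n+1)]. *)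
Lemma schur_flux x n : x 0%N = 0 ->
  pdot w (M *: x + jacobi x) (M *: x + jacobi x) n <= theta ^+ 2 * pdot w x x n +
    theta * (b n / w n.+1 * h n * h n.+1 *
      ((x n.+1 / h n.+1) ^+ 2 - (x n / h n) ^+ 2)).
Proof.
move=> x0; elim: n => [|n IH].
  rewrite !pdot0 x0 mul0r mulr0 add0r expr0n/= subr0.
  by have t0 := supersolution_rate_gt0; nonneg.
rewrite !pdotS edge_weight seqDE seqZE [jacobi x n.+1]/=.
have xE k : x k = h k * (x k / h k) by rewrite mulrC divfK ?gt_eqF.
set u := x n / h n in IH *; set v := x n.+1 / h n.+1 in IH *.
set z := x n.+2 / h n.+2.
rewrite (xE n.+1) -/v (xE n) -/u (xE n.+2) -/z.
(* [A], [B], [D] are the entries of the row times [h], and [u], [v], [z] the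
   values of [x / h]. *)
set A := b n * h n; set B := (M - (b n.+1 + beta)) * h n.+1.
set D := beta * h n.+2.
have A0 : 0 <= A by rewrite /A; nonneg.
have B0 : 0 <= B by rewrite mulr_ge0 ?subr_ge0 // ltW.
have D0 : 0 <= D by rewrite /D; nonneg.
rewrite [M * _ + _](_ : _ = A * u + B * v + D * z); last first.
  by rewrite /A /B /D; ring.
have := weighted_square_le u v z A0 B0 D0.
have S2 : 0 <= A * u ^+ 2 + B * v ^+ 2 + D * z ^+ 2.
  by nonneg.
move=> /le_trans/(_ (ler_wpM2r S2 (h_super n))) H.
have BE : B <= theta * h n.+1 - A - D.
  by have := h_super n; rewrite -/A -/B -/D; lra.
have hv : 0 <= theta * (h n.+1 / w n.+1).
  by have t0 := supersolution_rate_gt0; nonneg.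
have H2 : (A * u + B * v + D * z) ^+ 2 / w n.+1 <=
    theta * (h n.+1 / w n.+1) * (A * u ^+ 2 + B * v ^+ 2 + D * z ^+ 2).
  rewrite ler_pdivrMr//; apply: le_trans H _.
  by rewrite le_eqVlt; apply/orP; left; apply/eqP; field; rewrite gt_eqF.
have H3 : theta * (h n.+1 / w n.+1) * (A * u ^+ 2 + B * v ^+ 2 + D * z ^+ 2) <=
   theta * (h n.+1 / w n.+1) *
     (A * u ^+ 2 + (theta * h n.+1 - A - D) * v ^+ 2 + D * z ^+ 2).
  by rewrite ler_wpM2l// lerD2r lerD2l ler_wpM2r ?sqr_ge0.
move: IH H2 H3; rewrite -expr2; set P := pdot _ _ _ _; set Q := pdot _ _ _ _.
move=> IH H2 H3.
apply: (le_trans (lerD IH (le_trans H2 H3))).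
rewrite le_eqVlt; apply/orP; left; apply/eqP; rewrite /A /D; field.
by rewrite gt_eqF.
Qed.

(** The remaining flux is absorbed by one more term of the right-hand sum,
    using [h_super] at the far end of the edge. *)
Lemma schur_le x n : x 0%N = 0 ->
  pdot w (M *: x + jacobi x) (M *: x + jacobi x) n <= theta ^+ 2 * pdot w x x n.+1.
Proof.
move=> x0; apply: le_trans (schur_flux n x0) _.
rewrite pdotS [leRHS]mulrDr lerD2l (expr2 theta) -[leRHS]mulrA.
rewrite ler_wpM2l ?(ltW supersolution_rate_gt0)//.
have e0 : 0 <= b n / w n.+1 * h n * h n.+1.
  by nonneg.
apply: (@le_trans _ _ (b n / w n.+1 * h n * h n.+1 * (x n.+1 / h n.+1) ^+ 2)).
  by rewrite ler_wpM2l// gerBl sqr_ge0.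
have bh : b n * h n <= theta * h n.+1.
  apply: le_trans (h_super n); rewrite -addrA lerDl addr_ge0//.
    by rewrite mulr_ge0 ?subr_ge0// ltW.
  by rewrite mulr_ge0 ?ltW.
have s0 : 0 <= (w n.+1)^-1 * h n.+1 * (x n.+1 / h n.+1) ^+ 2.
  by nonneg.
have := ler_wpM2r s0 bh; congr (_ <= _); first by ring.
by field; rewrite !gt_eqF.
Qed.

Lemma L2_shift x : L2 w x -> L2 w (M *: x + jacobi x) /\
  L2norm w (M *: x + jacobi x) <= theta * L2norm w x.
Proof.
move=> Lx; have x0 : x 0%N = 0 by case: Lx.
apply: L2_le => //; first by rewrite seqDE seqZE x0 mulr0 addr0.
  by rewrite mulr_ge0 ?L2norm_ge0 ?(ltW supersolution_rate_gt0).
move=> n; apply: le_trans (schur_le n x0) _.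
by rewrite exprMn ler_wpM2l ?sqr_ge0// pdot_le.
Qed.

Lemma L2_jacobi x : L2 w x -> L2 w (jacobi x).
Proof.
move=> Lx; have := L2B w_gt0 (L2_shift Lx).1 (L2Z w_gt0 M Lx).
by rewrite addrAC subrr add0r.
Qed.

Lemma L2norm_jacobi x : L2 w x ->
  L2norm w (jacobi x) <= (theta + `|M|) * L2norm w x.
Proof.
move=> Lx; have [L1 n1] := L2_shift Lx; have L2x := L2Z w_gt0 (- M) Lx.
rewrite mulrDl -(normrN M) -(L2normZ w_gt0 _ Lx).
rewrite -[X in L2norm w X <= _](addKr (M *: x)) addrC -scaleNr.
by apply: le_trans (L2norm_triangle w_gt0 L1 L2x) _; rewrite lerD2r.
Qed.

End Schur.

(** Green's identity: only the last edge contributes, since both sequences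
    vanish at [0]. *)
Lemma green x y n : x 0%N = 0 -> y 0%N = 0 ->
  pdot w (jacobi x) y n - pdot w x (jacobi y) n =
  b n / w n.+1 * (x n.+1 * y n - x n * y n.+1).
Proof.
move=> x0 y0; elim: n => [|n IH]; first by rewrite !pdot0 x0 y0; ring.
rewrite !pdotS edge_weight /=.
set P := pdot w (jacobi x) y n in IH *; set Q := pdot w x (jacobi y) n in IH *.
rewrite opprD addrACA IH; ring.
Qed.

(** The conductance of an edge is [b k / w k.+1] seen from one end and
    [beta / w k] from the other, so the boundary term is dominated by two
    general terms of convergent series. *)
Lemma boundary_cvg0 x y : L2 w x -> L2 w y ->
  (fun n => b n / w n.+1 * (x n.+1 * y n)) @ \oo --> 0.
Proof.
move=> [_ cx] [_ cy]; rewrite -cvg_shiftS.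
have tx : (fun n => x n.+2 ^+ 2 / w n.+2) @ \oo --> 0.
  rewrite (cvg_shiftS (fun n => x n.+1 ^+ 2 / w n.+1)).
  exact: cvg_series_cvg_0 cx.
have ty := cvg_series_cvg_0 cy.
apply: norm_cvg0.
apply: (@squeeze_cvgr _ _ _ _ (fun=> 0) (fun n =>
  C * (x n.+2 ^+ 2 / w n.+2) + beta * (y n.+1 ^+ 2 / w n.+1))).
- near=> n; rewrite normr_ge0/=.
  have e0 : 0 <= b n.+1 / w n.+2 by rewrite divr_ge0 ?ltW.
  rewrite normrM ger0_norm//.
  apply: (@le_trans _ _ (b n.+1 / w n.+2 * (x n.+2 ^+ 2 + y n.+1 ^+ 2))).
    rewrite ler_wpM2l// normrM.
    have := sqr_ge0 (`|x n.+2| - `|y n.+1|).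
    rewrite sqrrB !real_normK ?num_real//.
    have := sqr_ge0 (x n.+2); have := sqr_ge0 (y n.+1); lra.
  rewrite mulrDr lerD//.
    by rewrite mulrAC -mulrA ler_wpM2r// divr_ge0 ?sqr_ge0 ?ltW.
  by rewrite edge_weight mulrAC mulrA.
- exact: cvg_cst.
- rewrite -[X in _ --> X]addr0 -[X in X + _](mulr0 C) -[X in _ + X](mulr0 beta).
  by apply: cvgD; apply: cvgMl_tmp.
Unshelve. all: by end_near. Qed.

Lemma jacobi_selfadjoint x y :
  L2 w x -> L2 w y -> L2 w (jacobi x) -> L2 w (jacobi y) ->
  L2dot w (jacobi x) y = L2dot w x (jacobi y).
Proof.
move=> Lx Ly LJx LJy; apply/eqP; rewrite -subr_eq0; apply/eqP.
have [x0 _] := Lx; have [y0 _] := Ly.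
have c1 : (fun n => pdot w (jacobi x) y n - pdot w x (jacobi y) n) @ \oo -->
    L2dot w (jacobi x) y - L2dot w x (jacobi y).
  by apply: cvgB; exact: cvg_pdot.
have c2 : (fun n => b n / w n.+1 * (x n.+1 * y n)
    - b n / w n.+1 * (y n.+1 * x n)) @ \oo --> (0 - 0 : R).
  by apply: cvgB; exact: boundary_cvg0.
rewrite subr0 in c2; rewrite -(cvg_lim (@Rhausdorff R) c1).
apply: cvg_lim => //; apply: cvg_trans c2.
rewrite (_ : (fun n => _ - _) = (fun n => b n / w n.+1 * (x n.+1 * y n)
    - b n / w n.+1 * (y n.+1 * x n)))//.
by apply/funext => n; rewrite green// mulrBr (mulrC (y _)).
Qed.

Section Supersolution.
Context (N : nat) (q : R).
Context (beta_le : beta <= C) (q_ge0 : 0 <= q) (q_lt1 : q < 1).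
Context (b_small : forall k, (N <= k)%N -> b k <= q * beta).

(** With [h_(k+1) / h_k = (b_k / beta) (1 + eps_k)] the inequality at [k+1]
    becomes [b_(k+1) eps_(k+1) + delta <= beta eps_k / (1 + eps_k)].  A constant
    small [eps] satisfies it where [b <= q beta] with [q < 1]; on the finitely
    many other sites [eps] decreases geometrically, fast enough to beat the
    bound [C] on [b]. *)
Lemma supersolution : exists h : nat -> R, exists2 delta : R, 0 < delta &
  (forall k, 0 < h k) /\
  forall k, b k * h k + (C + beta - (b k.+1 + beta)) * h k.+1 + beta * h k.+2
            <= (C + beta - delta) * h k.+1.
Proof.
(* [e] leaves half of the margin [1 - q]; [d] is chosen so that [C d] is a
   quarter of [beta], as [eps / (1 + eps)] is at least [eps / 2]. *)
pose e := (1 - q) / 2; pose d := beta / (4 * C).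
have C0 : 0 < C by exact: lt_le_trans beta_le.
have e0 : 0 < e by rewrite divr_gt0// subr_gt0.
have d0 : 0 < d by rewrite divr_gt0// mulr_gt0.
have d1 : d <= 1.
  by rewrite ler_pdivrMr ?mulr_gt0// mul1r; have := beta_le; have := C0; lra.
have Cd : C * d = beta / 4 by rewrite /d; field; rewrite gt_eqF.
pose eps k := e * d ^+ minn k N.
have eps0 k : 0 < eps k by rewrite mulr_gt0// exprn_gt0.
have be0 k : 0 < beta * eps k by exact: mulr_gt0.
have epse k : eps k <= e.
  by rewrite /eps ger_pMr// exprn_ile1// ltW.
have epsN k : eps N <= eps k.
  by rewrite /eps ler_pM2l// minnn ler_wiXn2l ?geq_minr// ltW.
pose delta := beta * eps N * ((1 - q) / 4).
have delta0 : 0 < delta.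
  by apply: mulr_gt0; [exact: mulr_gt0 | rewrite divr_gt0// subr_gt0].
pose h := fix h k := if k is j.+1 then b j / beta * (1 + eps j) * h j else 1 : R.
have hS k : h k.+1 = b k / beta * (1 + eps k) * h k by [].
have h0 k : 0 < h k.
  by elim: k => [|k IH]; rewrite ?ltr01// hS !mulr_gt0 ?invr_gt0// addr_gt0.
exists h, delta => //; split => // k.
have E : b k * h k = beta / (1 + eps k) * h k.+1.
  rewrite hS; field; rewrite !gt_eqF//; by rewrite addr_gt0.
have F : beta * h k.+2 = b k.+1 * (1 + eps k.+1) * h k.+1.
  by rewrite (hS k.+1); field; rewrite gt_eqF.
rewrite E F -!mulrDl ler_pM2r//.
suff : b k.+1 * eps k.+1 + delta <= beta - beta / (1 + eps k) by lra.
have e1 : e <= 1 / 2 by rewrite /e; have := q_ge0; lra.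
have V : beta - beta / (1 + eps k) >= beta * eps k * (1 - eps k).
  have p1 : 0 < 1 + eps k by rewrite addr_gt0.
  rewrite [X in _ <= X](_ : _ = beta * eps k / (1 + eps k)); last first.
    by field; rewrite gt_eqF.
  rewrite ler_pdivlMr//.
  have := mulr_ge0 (ltW (mulr_gt0 beta_gt0 (eps0 k))) (sqr_ge0 (eps k)); lra.
apply: le_trans V.
have [kN|kN] := ltnP k N.
- have eS : eps k.+1 = d * eps k.
    by rewrite /eps !(minn_idPl _)// 1?ltnW// exprS mulrCA.
  have -> : b k.+1 * eps k.+1 = b k.+1 * d * eps k by rewrite eS mulrA.
  have H1 : b k.+1 * d * eps k <= beta / 4 * eps k.
    by rewrite ler_pM2r// -Cd ler_pM2r.
  have H2 : delta <= beta * eps k / 4.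
    apply: (@le_trans _ _ (beta * eps N / 4)).
      rewrite /delta (ler_pM2l (be0 _)); have := q_ge0; lra.
    by rewrite ler_pM2r ?invr_gt0// ler_pM2l.
  have H3 : beta * eps k * (1 - eps k) >= beta * eps k * (1 / 2).
    rewrite (ler_pM2l (be0 _)); have := epse k; lra.
  lra.
- have eN j : (N <= j)%N -> eps j = eps N.
    by move=> /minn_idPr jN; rewrite /eps jN minnn.
  rewrite (eN k)// (eN k.+1) 1?ltnW//.
  have H1 : b k.+1 * eps N <= q * beta * eps N.
    by rewrite ler_pM2r// b_small// ltnW.
  have H3 : beta * eps N * (1 - eps N) >= beta * eps N * (1 - e).
    by rewrite (ler_pM2l (be0 _)) lerD2l lerN2.
  have H4 : delta <= beta * eps N * ((1 - q) / 2).
    rewrite /delta (ler_pM2l (be0 _)); have := q_lt1; lra.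
  have H5 : beta * eps N * (1 - e) =
      q * beta * eps N + beta * eps N * ((1 - q) / 2).
    by rewrite /e; field.
  lra.
Qed.

End Supersolution.
End BirthDeath.

(** * The exponential flow *)

Section Exponential.
Context (R : realType) (w : nat -> R) (w_gt0 : forall k, 0 < w k.+1).
Context (beta : R) (b : nat -> R) (m : R) (m_ge0 : 0 <= m).
Local Notation J := (jacobi beta b).
Context (J_L2 : forall x, L2 w x -> L2 w (J x)).
Context (J_bound : forall x, L2 w x -> L2norm w (J x) <= m * L2norm w x).
Context (z0 : nat -> R) (Lz0 : L2 w z0).
Implicit Types r s u : nat -> R.

Lemma iter_L2 n : L2 w (iter n J z0).
Proof. by elim: n => //= n; exact: J_L2. Qed.

Lemma iter_bound n : L2norm w (iter n J z0) <= m ^+ n * L2norm w z0.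
Proof.
elim: n => [|n IH]; first by rewrite expr0 mul1r.
apply: le_trans (J_bound (iter_L2 n)) _.
by rewrite exprS -mulrA ler_wpM2l.
Qed.

(** The sum of [r n *: J^n z0], taken coordinate by coordinate; the operator
    being local, this limit commutes with it without any estimate in norm. *)
Definition orbit_series r : nat -> R :=
  fun k => limn (series (fun n => r n * iter n J z0 k)).

Definition majorant r u : Prop :=
  cvgn (series u) /\ forall n, `|r n| * m ^+ n <= u n.

Lemma orbit_series_cvg r u k : majorant r u ->
  series (fun n => r n * iter n J z0 k) @ \oo --> orbit_series r k.
Proof.
move=> [cu ru]; suff : cvgn (series (fun n => r n * iter n J z0 k)) by [].
apply: normed_cvg => /=.
pose c := Num.sqrt (w k) * L2norm w z0.
have c0 : 0 <= c by rewrite mulr_ge0 ?sqrtr_ge0.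
have u0 n : 0 <= u n by apply: le_trans (ru n); rewrite mulr_ge0// exprn_ge0.
apply: (@series_le_cvg _ _ (c *: u)) => //.
- by move=> n; exact: normr_ge0.
- by move=> n; rewrite seqZE mulr_ge0.
- move=> n; rewrite seqZE /= normrM.
  apply: (@le_trans _ _ (`|r n| * (Num.sqrt (w k) * (m ^+ n * L2norm w z0)))).
    rewrite ler_wpM2l//; apply: le_trans (L2_coord w_gt0 k (iter_L2 n)) _.
    by rewrite ler_wpM2l ?sqrtr_ge0// iter_bound.
  rewrite [X in X <= _](_ : _ = c * (`|r n| * m ^+ n)); first by rewrite ler_wpM2l.
  by rewrite /c; ring.
- exact: is_cvg_seriesZ.
Qed.

(** Completeness in the form used here: the truncations to finitely many
    coordinates of the partial sums are bounded by the majorant, and both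
    truncations are removed one after the other. *)
Lemma orbit_series_le r u : majorant r u ->
  L2 w (orbit_series r) /\
  L2norm w (orbit_series r) <= limn (series u) * L2norm w z0.
Proof.
move=> ru; have [cu ruM] := ru.
have u0 n : 0 <= u n by apply: le_trans (ruM n); rewrite mulr_ge0// exprn_ge0.
have u_homo : {homo series u : i j / (i <= j)%N >-> i <= j}.
  apply/nondecreasing_seqP => n; by rewrite /series/= big_nat_recr//= lerDl.
have su n : series u n <= limn (series u) by exact: nondecreasing_cvgn_le.
have lu0 : 0 <= limn (series u).
  by apply: le_trans (su 0%N); rewrite /series/= big_geq.
pose S n := \sum_(i < n) r i *: iter i J z0.
have LS n : L2 w (S n) by apply: L2_sum => // i; apply: L2Z => //; exact: iter_L2.
have SE n k : S n k = series (fun n => r n * iter n J z0 k) n.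
  rewrite /series/= big_mkord /S; elim/big_ind2: _ => // x1 x2 y1 y2 e1 e2.
  by rewrite seqDE e1 e2.
have nS n : L2norm w (S n) <= limn (series u) * L2norm w z0.
  apply: le_trans (L2norm_sum w_gt0 _ _) _.
    by move=> i; apply: L2Z => //; exact: iter_L2.
  apply: (@le_trans _ _ (series u n * L2norm w z0)); last first.
    by rewrite ler_wpM2r ?L2norm_ge0.
  rewrite /series/= big_mkord mulr_suml; apply: ler_sum => i _.
  rewrite L2normZ//; last exact: iter_L2.
  apply: (@le_trans _ _ (`|r i| * (m ^+ i * L2norm w z0))).
    by rewrite ler_wpM2l// iter_bound.
  by rewrite mulrA ler_wpM2r ?L2norm_ge0.
apply: L2_le => //.
- rewrite /orbit_series (_ : (fun n => _) = (fun=> 0)).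
    by rewrite /series/= (_ : (fun n => _) = fun=> 0) ?lim_cst//;
       apply/funext => n; rewrite big1.
  by apply/funext => n; case: (iter_L2 n) => -> _; rewrite mulr0.
- by rewrite mulr_ge0 ?L2norm_ge0.
move=> n.
have c : pdot w (S N) (S N) n @[N --> \oo] -->
    pdot w (orbit_series r) (orbit_series r) n.
  elim: n => [|n IH].
    rewrite pdot0 (_ : (fun N => _) = fun=> 0); first exact: cvg_cst.
    by apply/funext => N; rewrite pdot0.
  rewrite pdotS; under eq_fun do rewrite pdotS.
  apply: cvgD => //; apply: cvgMr_tmp.
  under eq_fun do rewrite !SE.
  by apply: cvgM; exact: orbit_series_cvg ru.
have <- := cvg_lim (@Rhausdorff R) c.
apply: limr_le; first by apply/cvg_ex; eexists; exact: c.
near=> N; apply: le_trans (pdot_le w_gt0 n (LS N)) _.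
by rewrite ler_sqr ?nnegrE ?L2norm_ge0// mulr_ge0 ?L2norm_ge0.
Unshelve. all: by end_near. Qed.

Lemma majorant_lin a r s u v : majorant r u -> majorant s v ->
  majorant (a *: r + s) (`|a| *: u + v).
Proof.
move=> [cu ru] [cv sv]; split.
  by apply: is_cvg_seriesD => //; exact: is_cvg_seriesZ.
move=> n; rewrite !seqDE !seqZE.
apply: (@le_trans _ _ ((`|a| * `|r n| + `|s n|) * m ^+ n)).
  by rewrite ler_wpM2r ?exprn_ge0// (le_trans (ler_normD _ _))// normrM.
by rewrite mulrDl -mulrA lerD// ler_wpM2l.
Qed.

Lemma orbit_series_lin a r s u v : majorant r u -> majorant s v ->
  orbit_series (a *: r + s) = a *: orbit_series r + orbit_series s.
Proof.
move=> ru sv; apply/funext => k; rewrite seqDE seqZE.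
apply: cvg_lim => //.
rewrite (_ : series _ = fun N => a * series (fun n => r n * iter n J z0 k) N +
  series (fun n => s n * iter n J z0 k) N).
  apply: cvgD; last exact: orbit_series_cvg sv.
  by apply: cvgMl_tmp; exact: orbit_series_cvg ru.
apply/funext => N; rewrite /series/= mulr_sumr -big_split/=.
by apply: eq_bigr => n _; rewrite seqDE seqZE mulrDl mulrA.
Qed.

Lemma majorant0 : majorant 0 0.
Proof.
split; last by move=> n; rewrite normr0 mul0r.
rewrite (_ : series _ = fun=> 0); first exact: is_cvg_cst.
by apply/funext => n; rewrite /series/= big1.
Qed.

Lemma orbit_series0 : orbit_series 0 = 0.
Proof.
apply/funext => k; apply: cvg_lim => //.
rewrite (_ : series _ = fun=> 0); first exact: cvg_cst.
by apply/funext => n; rewrite /series/= big1// => i _; rewrite mul0r.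
Qed.

Lemma majorantZ a r u : majorant r u -> majorant (a *: r) (`|a| *: u).
Proof.
move=> ru; rewrite -[a *: r]addr0 -[_ *: u]addr0.
exact: majorant_lin ru majorant0.
Qed.

Lemma orbit_seriesZ a r u : majorant r u ->
  orbit_series (a *: r) = a *: orbit_series r.
Proof.
move=> ru; rewrite -[a *: r]addr0 (orbit_series_lin _ ru majorant0).
by rewrite orbit_series0 addr0.
Qed.

Definition shiftc r : nat -> R := fun n => if n is p.+1 then r p else 0.

Lemma orbit_series_shift r u : majorant r u ->
  orbit_series (shiftc r) = J (orbit_series r).
Proof.
move=> ru; apply/funext => k; apply: cvg_lim => //; rewrite -cvg_shiftS.
have c j := @orbit_series_cvg r u j ru.
rewrite (_ : [sequence _]_n =
  (fun N => series (fun n => r n * J (iter n J z0) k) N)).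
  case: k => [|k] /=.
    rewrite (_ : series _ = fun=> 0); first exact: cvg_cst.
    by apply/funext => N; rewrite /series/= big1// => i _; rewrite mulr0.
  rewrite (_ : series _ = fun N =>
    b k * series (fun n => r n * iter n J z0 k) N
    - (b k.+1 + beta) * series (fun n => r n * iter n J z0 k.+1) N
    + beta * series (fun n => r n * iter n J z0 k.+2) N).
    by apply: cvgD; [apply: cvgB|]; apply: cvgMl_tmp; exact: c.
  apply/funext => N; rewrite /series/= !mulr_sumr -sumrB -big_split/=.
  by apply: eq_bigr => n _; ring.
apply/funext => N; rewrite /series/= big_nat_recl//= mul0r add0r.
by [].
Qed.

Lemma orbit_series_finite r N :
  orbit_series (fun n => if (n < N)%N then r n else 0) =
  \sum_(n < N) r n *: iter n J z0.
Proof.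
apply/funext => k; apply: lim_near_cst => //; near=> p.
rewrite /series/= (@big_cat_nat _ _ _ N)//=; last by near: p; exists N.
rewrite [X in _ + X]big_nat_cond [X in _ + X]big1 ?addr0; last first.
  by move=> i /andP[/andP[Ni _] _]; rewrite ltnNge Ni/= mul0r.
rewrite big_mkord; elim/big_ind2: _ => // [x1 x2 y1 y2 -> -> //|i _].
by rewrite ltn_ord.
Unshelve. all: by end_near. Qed.

Lemma majorant_exp t : majorant (exp_coeff t) (exp_coeff (`|t| * m)).
Proof.
split; first exact: is_cvg_series_exp_coeff.
move=> n; rewrite /exp_coeff/= normrM normrX normfV (ger0_norm (ler0n _ _)).
by rewrite exprMn mulrAC.
Qed.

Definition expflow t := orbit_series (exp_coeff t).

Lemma expflow_L2 t : L2 w (expflow t).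
Proof. exact: (orbit_series_le (majorant_exp t)).1. Qed.

Lemma expflow0 : expflow 0 = z0.
Proof.
have := orbit_series_finite (exp_coeff 0) 1; rewrite big_ord1 /exp_coeff/= expr0.
rewrite divr1 scale1r => <-; congr orbit_series; apply/funext => -[|n].
  by [].
by rewrite /exp_coeff/= expr0n mul0r.
Qed.

Lemma expflow_expop t : is_expop w J t z0 (expflow t).
Proof.
split; first exact: expflow_L2.
have me := majorant_exp t.
pose e n := `|exp_coeff t n| * m ^+ n.
have eE : e = exp_coeff (`|t| * m).
  apply/funext => n; rewrite /e /exp_coeff/= normrM normrX normfV.
  by rewrite (ger0_norm (ler0n _ _)) exprMn mulrAC.
have ce : cvgn (series e) by rewrite eE; exact: is_cvg_series_exp_coeff.
pose trunc N := fun n => if (n < N)%N then exp_coeff t n else 0.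
(* The tail of the exponential series is a series along the orbit, with the
   tail of the numerical series as a majorant. *)
pose tail N := fun n => if (n < N)%N then 0 else e n.
have tailE N : series (tail N) @ \oo --> limn (series e) - series e N.
  apply: (@cvg_trans _ ((fun p => series e p - series e N) @ \oo)).
    apply: near_eq_cvg; near=> p.
    have Np : (N <= p)%N by near: p; exists N.
    rewrite /series/= !(@big_cat_nat _ _ _ N 0 p)//= addrAC subrr add0r.
    rewrite [X in _ = X + _]big_nat_cond [X in _ = X + _]big1 ?add0r; last first.
      by move=> i /andP[/andP[_ iN] _]; rewrite /tail iN.
    apply: eq_big_nat => i /andP[Ni _]; by rewrite /tail ltnNge Ni.
  by apply: cvgB => //; exact: cvg_cst.
have maj N : majorant (exp_coeff t - trunc N) (tail N).
  split; first by apply/cvg_ex; eexists; exact: tailE.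
  move=> n; rewrite seqDE [(- trunc N) n]/(- trunc N n) /trunc /tail.
  by case: ifP => _; rewrite ?subrr ?normr0 ?mul0r// subr0.
have diffE N : expflow t - \sum_(n < N) (t ^+ n / n`!%:R) *: iter n J z0
    = orbit_series (exp_coeff t - trunc N).
  have mt : majorant (trunc N) e.
    split => // n; rewrite /trunc; case: ifP => // _.
    by rewrite normr0 mul0r /e mulr_ge0 ?exprn_ge0.
  rewrite (_ : exp_coeff t - trunc N = -1 *: trunc N + exp_coeff t).
    by rewrite (orbit_series_lin _ mt me) scaleN1r orbit_series_finite addrC.
  by rewrite scaleN1r addrC.
apply: (@squeeze_cvgr _ _ _ _ (fun=> 0)
  (fun N => (limn (series e) - series e N) * L2norm w z0)).
- near=> N; rewrite L2norm_ge0/= diffE.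
  rewrite -(cvg_lim (@Rhausdorff R) (tailE N)).
  exact: (orbit_series_le (maj N)).2.
- exact: cvg_cst.
- rewrite -[X in _ --> X](mul0r (L2norm w z0)); apply: cvgMr_tmp.
  by rewrite -(subrr (limn (series e))); apply: cvgB => //; exact: cvg_cst.
Unshelve. all: by end_near. Qed.

(** The remainders [D_n] of the powers satisfy
    [D_(n+1) = s D_n + n t^(n-1) (s - t)^2], whence the geometric bound by
    induction, using [n <= 2^n]. *)
Lemma taylor_pow_bound (K s t : R) n : 1 <= K -> `|s| <= K -> `|t| <= K ->
  `|s ^+ n - t ^+ n - n%:R * t ^+ n.-1 * (s - t)| <= `|s - t| ^+ 2 * (2 * K) ^+ n.
Proof.
move=> K1 sK tK; have K0 : 0 <= K by exact: le_trans K1.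
have p0 := sqr_ge0 `|s - t|.
elim: n => [|n IH].
  by rewrite !expr0 subrr mul0r mul0r subr0 normr0 mulr1.
rewrite (_ : _ - _ = s * (s ^+ n - t ^+ n - n%:R * t ^+ n.-1 * (s - t))
    + n%:R * t ^+ n.-1 * (s - t) ^+ 2); last first.
  case: n {IH} => [|n]; rewrite ?expr0 ?expr1/=; first by ring.
  rewrite !exprS -(natr1 n.+1); ring.
apply: le_trans (ler_normD _ _) _.
rewrite !normrM !normrX.
rewrite (ger0_norm (ler0n _ _)) [(2 * K) ^+ n.+1]exprS.
apply: (@le_trans _ _ (K * (`|s - t| ^+ 2 * (2 * K) ^+ n) +
   `|s - t| ^+ 2 * (K * (2 * K) ^+ n))); last first.
  by rewrite le_eqVlt; apply/orP; left; apply/eqP; ring.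
apply: lerD; first by apply: ler_pM.
rewrite [leLHS]mulrC ler_wpM2l// exprMn mulrCA.
apply: ler_pM; rewrite ?exprn_ge0//.
  by rewrite -natrX ler_nat ltnW// ltn_expl.
apply: (@le_trans _ _ (K ^+ n.-1)); first by rewrite lerXn2r ?nnegrE.
by rewrite -exprS ler_weXn2l// (leq_trans (leq_pred _)).
Qed.

(** The difference quotient minus [J (expflow t)] is again a series along the
    orbit of [z0], with coefficients of size [|s - t|]. *)
Lemma expflow_derive t :
  (fun s : R => L2norm w ((s - t)^-1 *: (expflow s - expflow t) - J (expflow t)))
    @ t^' --> (0 : R).
Proof.
pose K := `|t| + 1.
have K1 : 1 <= K by rewrite lerDr.
pose c := limn (series (exp_coeff (2 * K * m))) * L2norm w z0.
apply: (@squeeze_cvgr _ _ _ _ (fun=> 0 : R) (fun s : R => `|s - t| * c : R)).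
- near=> s; rewrite L2norm_ge0/=.
  have st : s - t != 0 by rewrite subr_eq0; near: s; exact: nbhs_dnbhs_neq.
  have st1 : `|s - t| < 1.
    near: s; apply: nbhs_dnbhs; apply/nbhs_ballP; exists 1 => //= s.
    by rewrite /ball/= distrC.
  have sK : `|s| <= K.
    rewrite -(subrK t s) addrC; apply: le_trans (ler_normD _ _) _.
    by rewrite lerD2l ltW.
  pose D : nat -> R := (s - t)^-1 *: exp_coeff s + ((- (s - t)^-1) *: exp_coeff t
    + (- 1) *: shiftc (exp_coeff t)).
  have mshift : majorant (shiftc (exp_coeff t))
      (shiftc (m *: exp_coeff (`|t| * m))).
    have [ct le] := majorant_exp t; split.
      apply/cvg_ex; exists (m * limn (series (exp_coeff (`|t| * m)))).
      rewrite -cvg_shiftS (_ : [sequence _]_n =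
        fun N => m * series (exp_coeff (`|t| * m)) N).
        exact: cvgMl_tmp.
      apply/funext => N; rewrite /series/= big_nat_recl//= add0r mulr_sumr.
      by [].
    move=> [|n] /=; first by rewrite normr0 mul0r.
    by rewrite exprS mulrCA ler_wpM2l.
  have zE : (s - t)^-1 *: (expflow s - expflow t) - J (expflow t) = orbit_series D.
    rewrite (orbit_series_lin _ (majorant_exp s)
      (majorant_lin _ (majorant_exp t) (majorantZ _ mshift))).
    rewrite (orbit_series_lin _ (majorant_exp t) (majorantZ _ mshift)).
    rewrite (orbit_seriesZ _ mshift) (orbit_series_shift (majorant_exp t)).
    by rewrite scaleN1r scalerBr scaleNr addrA.
  have DE n : D n = (s - t)^-1 / n`!%:R *
      (s ^+ n - t ^+ n - n%:R * t ^+ n.-1 * (s - t)).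
    rewrite /D !seqDE !seqZE /shiftc /exp_coeff/=.
    case: n => [|n]; first (rewrite !expr0; field; rewrite ?st ?pnatr_eq0//).
    rewrite factS natrM /=; field; rewrite st/=.
    by rewrite nat1r !pnatr_eq0 -lt0n fact_gt0.
  have Dm : majorant D (`|s - t| *: exp_coeff (2 * K * m)).
    split; first by apply: is_cvg_seriesZ; exact: is_cvg_series_exp_coeff.
    move=> n; rewrite seqZE DE /exp_coeff/= !normrM !normfV (ger0_norm (ler0n _ n`!)).
    have f0 : 0 <= n`!%:R^-1 :> R by rewrite invr_ge0.
    have := taylor_pow_bound n K1 sK (_ : `|t| <= K).
    rewrite lerDl ler01 => /(_ isT); move: (_ - _ * (s - t)) => d H.
    apply: (@le_trans _ _ (`|s - t|^-1 / n`!%:R *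
        (`|s - t| ^+ 2 * (2 * K) ^+ n) * m ^+ n)).
      by rewrite ler_wpM2r ?exprn_ge0// ler_wpM2l// mulr_ge0// invr_ge0.
    rewrite [(2 * K * m) ^+ n]exprMn le_eqVlt; apply/orP; left; apply/eqP.
    field.
    by rewrite normr_eq0 st pnatr_eq0 -lt0n fact_gt0.
  rewrite zE; apply: le_trans (orbit_series_le Dm).2 _.
  rewrite /c mulrA lim_seriesZ//; exact: is_cvg_series_exp_coeff.
- exact: cvg_cst.
- rewrite -(mul0r c); apply: cvgMr_tmp.
  rewrite -[X in _ --> X](@normr0 _ R) -(subrr t); apply: cvg_norm.
  apply: cvgB; last exact: cvg_cst.
  by apply: cvg_within_filter; exact: cvg_id.
Unshelve. all: by end_near. Qed.

Lemma expflow_ode : solves_ode w J expflow.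
Proof.
split=> [t _|t _]; first exact: expflow_L2.
by apply: cvg_within_filter; exact: expflow_derive.
Qed.

End Exponential.

(** * Energy estimates for the evolution equation *)

Section Gronwall.
Context (R : realType) (f g : R -> R) (c : R).
Context (f_quot : forall t : R, 0 <= t ->
  (fun s : R => (s - t)^-1 * (f s - f t)) @ within `[0, +oo[ t^' --> g t).
Context (g_le : forall t : R, 0 <= t -> g t <= c * f t).

Lemma quot_is_derive (t : R) : 0 < t -> is_derive t (1 : R) f (g t).
Proof.
move=> t0; have H : (fun h : R => h^-1 *: (f (h *: 1 + t) - f t)) @ 0^' --> g t.
  move=> P /(f_quot (ltW t0)) /nbhs_ballP[e /= e0 He].
  apply/nbhs_ballP; exists (Num.min e t) => /=; first by rewrite lt_min e0 t0.
  move=> h /= + h0; rewrite /ball/= sub0r normrN lt_min => /andP[he ht].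
  have := He (h + t); rewrite /ball/= opprD addrCA subrr addr0 normrN => /(_ he).
  rewrite -subr_eq0 addrK => /(_ h0).
  rewrite in_itv/= andbT [h *: 1]mulr1; apply.
  by move: ht; rewrite ltr_norml => /andP[+ _]; lra.
split; last exact: cvg_lim H.
by apply/cvg_ex; exists (g t).
Qed.

(** At the endpoint only right continuity is available, and it suffices for
    the mean value argument. *)
Lemma quot_cvg_right : f @ 0^'+ --> f 0.
Proof.
have q0 : (fun s : R => (s - 0)^-1 * (f s - f 0)) @ 0^'+ --> g 0.
  move=> P /(f_quot (lexx 0)) /nbhs_ballP[e /= e0 He].
  apply/nbhs_ballP; exists e => //= s se s0; apply: He => //.
    by rewrite gt_eqF.
  by rewrite /= in_itv/= ltW.
have H : (fun s : R => f 0 + s * ((s - 0)^-1 * (f s - f 0))) @ 0^'+ --> f 0 + 0 * g 0.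
  apply: cvgD; first exact: cvg_cst.
  by apply: cvgM => //; apply: cvg_at_right_filter; exact: cvg_id.
rewrite mul0r addr0 in H; apply: cvg_trans H; apply: near_eq_cvg.
near=> s; have s0 : s != 0 by rewrite gt_eqF//; near: s; exact: nbhs_right_gt.
by rewrite subr0; field.
Unshelve. all: by end_near. Qed.

Lemma gronwall (t : R) : 0 <= t -> f t <= expR (c * t) * f 0.
Proof.
rewrite le_eqVlt => /predU1P[<-|t0]; first by rewrite mulr0 expR0 mul1r.
pose F (s : R) := expR (- c * s) * f s.
have dE (s : R) : is_derive s (1 : R) (fun u : R => expR (- c * u))
    (- c * expR (- c * s)).
  have dm : is_derive s (1 : R) (fun u : R => - c * u) (- c).
    apply: (is_derive_eq (is_deriveZ (- c) _)).
    by rewrite [_ *: _]mulr1.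
  rewrite [- c * expR _]mulrC.
  exact: (@is_derive1_comp _ expR (fun u : R => - c * u)).
have dF (s : R) : 0 < s -> is_derive s (1 : R) F (expR (- c * s) * (g s - c * f s)).
  move=> s0; have df := quot_is_derive s0.
  apply: is_derive_eq; rewrite /GRing.scale/=. ring.
have cF (s : R) : 0 < s -> {for s, continuous F}.
  move=> s0; apply: differentiable_continuous; apply/derivable1_diffP.
  by have := dF s s0; case.
have cE : {for 0, continuous (fun u : R => expR (- c * u))}.
  apply: differentiable_continuous; apply/derivable1_diffP.
  by have := dE 0; case.
have D1 x : x \in `]0, t[ -> derivable F x 1.
  by rewrite in_itv/= => /andP[x0 _]; have := dF x x0; case.
have D2 x : x \in `]0, t[ -> F^`()%classic x <= 0.
  rewrite in_itv/= => /andP[x0 _].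
  rewrite derive1E (@derive_val _ _ _ _ _ _ _ (dF x x0)).
  by rewrite mulr_ge0_le0 ?expR_ge0// subr_le0 g_le// ltW.
have D3 : {within `[0, t], continuous F}.
  apply/continuous_within_itvP => //; split.
  - by move=> x; rewrite in_itv/= => /andP[x0 _]; exact: cF.
  - apply: cvgM; last exact: quot_cvg_right.
    by apply: cvg_at_right_filter; exact: cE.
  - by apply: cvg_at_left_filter; exact: cF.
have t01 : 0 \in `[0, t] by rewrite in_itv/= lexx ltW.
have tt1 : t \in `[0, t] by rewrite in_itv/= lexx ltW.
have FF : F t <= F 0 := ler0_derive1_le_cc D1 D2 D3 tt1 t01 (ltW t0).
rewrite /F mulr0 expR0 mul1r mulNr expRN in FF.
by rewrite mulrC -ler_pdivrMr ?expR_gt0// mulrC.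
Qed.

End Gronwall.

Lemma near_within_neq (R : realType) (t : R) (D : set R) :
  \forall s \near within D t^', s != t.
Proof.
by rewrite near_withinE; near=> s => _; near: s; exact: nbhs_dnbhs_neq.
Unshelve. all: by end_near. Qed.

Section Energy.
Context (R : realType) (w : nat -> R) (w_gt0 : forall k, 0 < w k.+1).
Context (T : (nat -> R) -> nat -> R) (T_L2 : forall x, L2 w x -> L2 w (T x)).

(** Write [z s = z t + (s - t) (T (z t) + d s)] with [d s] tending to [0] and
    expand the square of the norm. *)
Lemma energy_quot (z : R -> nat -> R) (t : R) : solves_ode w T z -> 0 <= t ->
  (fun s : R => (s - t)^-1 * (L2norm w (z s) ^+ 2 - L2norm w (z t) ^+ 2))
    @ within `[0, +oo[ t^' --> 2 * L2dot w (T (z t)) (z t).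
Proof.
move=> [Lz dz] t0; have Lzt := Lz t t0; have LT := T_L2 Lzt.
set v := T (z t) in LT *.
pose d (s : R) := (s - t)^-1 *: (z s - z t) - v.
have d0 : (fun s : R => L2norm w (d s)) @ within `[0, +oo[ t^' --> (0 : R) by exact: dz.
have h0 : (fun s : R => `|s - t|) @ within `[0, +oo[ t^' --> (0 : R).
  rewrite -[X in _ --> X](@normr0 _ R) -(subrr t); apply: cvg_norm.
  apply: cvgB; last exact: cvg_cst.
  by do 2 apply: cvg_within_filter; exact: cvg_id.
pose bnd (s : R) := 2 * (L2norm w (z t) * L2norm w (d s))
  + `|s - t| * ((L2norm w v + L2norm w (d s)) * (L2norm w v + L2norm w (d s))).
have b0 : bnd @ (within `[0, +oo[ t^') --> (0 : R).
  rewrite [X in _ --> X](_ : 0 = 2 * (L2norm w (z t) * 0)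
    + 0 * ((L2norm w v + 0) * (L2norm w v + 0))); last by ring.
  apply: cvgD; first by apply: cvgMl_tmp; apply: cvgMl_tmp; exact: d0.
  have vd : (fun s => L2norm w v + L2norm w (d s)) @ within `[0, +oo[ t^'
      --> L2norm w v + 0 by apply: cvgD; [exact: cvg_cst | exact: d0].
  by apply: cvgM; [exact: h0 | apply: cvgM].
apply/subr_cvg0; apply: norm_cvg0.
apply: (@squeeze_cvgr _ _ _ _ (fun=> 0 : R) bnd) => //; last exact: cvg_cst.
near=> s; rewrite normr_ge0/=.
have s0 : 0 <= s.
  have : `[0, +oo[%classic s by near: s; exact: withinT.
  by rewrite /= in_itv/= andbT.
have st : s - t != 0 by rewrite subr_eq0; near: s; exact: near_within_neq.
have Lzs := Lz s s0.
have Ld : L2 w (d s) by apply: L2B => //; apply: L2Z => //; exact: L2B.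
have zE : z s = z t + (s - t) *: (v + d s).
  by rewrite /d (addrC v) subrK scalerA divff// scale1r addrC subrK.
have Lvd : L2 w (v + d s) by exact: L2D.
rewrite {1}zE (L2norm_sqrD w_gt0)//; last exact: L2Z.
rewrite (L2normZ w_gt0)// (L2dotZr w_gt0)// exprMn real_normK ?num_real//.
rewrite (L2dotDr w_gt0)// (L2dotC _ v).
rewrite [X in `|X|](_ : _ = 2 * L2dot w (z t) (d s)
  + (s - t) * L2norm w (v + d s) ^+ 2); last by field.
apply: le_trans (ler_normD _ _) _; rewrite !normrM; apply: lerD.
  by rewrite ger0_norm// ler_wpM2l// CauchySchwarz_abs.
rewrite ler_wpM2l// (ger0_norm (L2norm_ge0 _ _)) -!expr2.
by rewrite lerXn2r ?nnegrE ?addr_ge0 ?L2norm_ge0// L2norm_triangle.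
Unshelve. all: by end_near. Qed.

Lemma energy_decay (z : R -> nat -> R) c : solves_ode w T z ->
  (forall x, L2 w x -> L2dot w (T x) x <= c * L2norm w x ^+ 2) ->
  forall t, 0 <= t -> L2norm w (z t) <= expR (c * t) * L2norm w (z 0).
Proof.
move=> zs Tc t t0.
rewrite -ler_sqr ?nnegrE ?mulr_ge0 ?expR_ge0 ?L2norm_ge0//.
rewrite exprMn -expRM_natl mulrA mulr_natl.
apply: (@gronwall _ (fun s : R => L2norm w (z s) ^+ 2) _ (c *+ 2)
  (fun s => @energy_quot z s zs)) => // s s0.
by rewrite /= -[c *+ 2]mulr_natl -mulrA ler_pM2l//; apply: Tc; case: zs => /(_ s s0).
Qed.

(** The energy of a difference of solutions grows at most exponentially and
    starts from [0]. *)
Lemma ode_unique m (z z' : R -> nat -> R) :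
  (forall a x y, T (a *: x + y) = a *: T x + T y) ->
  (forall x, L2 w x -> L2norm w (T x) <= m * L2norm w x) ->
  solves_ode w T z -> solves_ode w T z' -> z' 0 = z 0 ->
  forall t, 0 <= t -> z' t = z t.
Proof.
move=> Tlin Tm sz sz' e0 t t0.
pose d (s : R) := z' s - z s.
have [Lz dz] := sz; have [Lz' dz'] := sz'.
have Ld (s : R) : 0 <= s -> L2 w (d s).
  by move=> s0; apply: L2B; [|exact: Lz'|exact: Lz].
have TB x y : T (x - y) = T x - T y.
  by rewrite addrC -scaleN1r Tlin scaleN1r addrC.
have sd : solves_ode w T d.
  split=> // s s0.
  apply: (@squeeze_cvgr _ _ _ _ (fun=> 0 : R) (fun u : R =>
    L2norm w ((u - s)^-1 *: (z' u - z' s) - T (z' s)) +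
    L2norm w ((u - s)^-1 *: (z u - z s) - T (z s)))).
  - near=> u; rewrite L2norm_ge0/=.
    have u0 : 0 <= u.
      have : `[0, +oo[%classic u by near: u; exact: withinT.
      by rewrite /= in_itv/= andbT.
    have L1 y (sy : solves_ode w T y) :
        L2 w ((u - s)^-1 *: (y u - y s) - T (y s)).
      have [Ly _] := sy; apply: L2B => //; last exact/T_L2/Ly.
      by apply: L2Z => //; apply: L2B => //; exact: Ly.
    have L1z := L1 _ sz.
    set q := _ - T (z s) in L1z *.
    have -> : L2norm w q = L2norm w (-1 *: q).
      by rewrite (L2normZ w_gt0)// normrN1 mul1r.
    apply: le_trans (L2norm_triangle w_gt0 (L1 _ sz') (L2Z w_gt0 _ L1z)).
    rewrite le_eqVlt; apply/orP; left; apply/eqP; congr L2norm.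
    rewrite TB scaleN1r /q /d !scalerBr !opprD !opprK.
    by apply/funext => k; rewrite !seqDE; ring.
  - exact: cvg_cst.
  - rewrite -[X in _ --> X]addr0; apply: cvgD; [exact: dz' | exact: dz].
have := @energy_decay d m sd _ t t0.
rewrite {2}/d e0 subrr (L2norm0 w_gt0) mulr0 => H.
have {}H : L2norm w (d t) <= 0.
  apply: H => x Lx; rewrite expr2 mulrA.
  apply: le_trans (CauchySchwarz w_gt0 (T_L2 Lx) Lx) _.
  by rewrite ler_wpM2r ?L2norm_ge0// Tm.
apply/eqP; rewrite -subr_eq0; apply/eqP.
apply: (L2norm0_eq0 w_gt0 (Ld t t0)); apply/eqP.
by rewrite eq_le H L2norm_ge0.
Unshelve. all: by end_near. Qed.

End Energy.

(** * The bottom of the support of a probability measure *)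

Section SupportBottom.
Context (R : realType) (psi : probability (measurableTypeR R) R).

Lemma measurable_ray t : measurable (`]-oo, t[%classic : set (measurableTypeR R)).
Proof. exact: measurable_itv. Qed.

(** The least point of the support is the supremum of the [t] below which there
    is no mass: every neighbourhood of the supremum is charged, otherwise mass
    would start even later. *)
Lemma exists_spectral_bottom t0 c : psi `]-oo, t0[%classic = 0%E ->
  (forall t, psi `]-oo, t[%classic = 0%E -> t <= c) ->
  exists gamma, [/\ is_least (measure_support psi) gamma, t0 <= gamma, gamma <= c
    & forall t, t < gamma -> psi `]-oo, t[%classic = 0%E].
Proof.
move=> pt0 Ac; pose A := [set t : R | psi `]-oo, t[%classic = 0%E].
have A0 : A t0 by [].
have ubA : ubound A c by move=> t /Ac.
have supA : has_sup A := conj (ex_intro _ t0 A0) (ex_intro _ c ubA).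
have below t : t < sup A -> psi `]-oo, t[%classic = 0%E.
  move=> tA; have tA0 : 0 < sup A - t by rewrite subr_gt0.
  have [a Aa] := sup_adherent tA0 supA; rewrite opprB addrC subrK => ta.
  apply/eqP; rewrite -measure_le0 -[leRHS]Aa; apply: le_measure; rewrite ?inE.
  - exact: measurable_ray.
  - exact: measurable_ray.
  - by apply: subset_itvl; rewrite bnd_simp ltW.
exists (sup A); split => //; last 2 first.
- by apply: ub_le_sup => //; exists c.
- by apply: ge_sup => //; exists t0.
split; last first.
  move=> x Sx; rewrite leNgt; apply/negP => xA.
  have xm : x < (x + sup A) / 2 by lra.
  have mA : (x + sup A) / 2 < sup A by lra.
  have := Sx `]-oo, ((x + sup A) / 2)[%classic (interval_open _ _).
  rewrite /= in_itv/= xm => /(_ isT isT isT).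
  by rewrite below// ltxx.
move=> U oU UA; rewrite lt0e measure_ge0 andbT; apply/negP => /eqP pU.
have /nbhs_ballP[e /= e0 eU] : nbhs (sup A) U by exact: open_nbhs_nbhs.
suff : A (sup A + e / 2).
  by move=> /(ub_le_sup (ex_intro _ c ubA)); lra.
have mU : measurable (U : set (measurableTypeR R)) by exact: open_measurable.
have : (psi (`]-oo, (sup A - e / 2)%R[%classic `|` U) <= 0)%E.
  apply: le_trans (measureU2 psi (measurable_ray _) mU) _.
  have b0 : psi `]-oo, (sup A - e / 2)[%classic = 0%E by apply: below; lra.
  by rewrite [X in (X + _)%E]b0 [X in (_ + X)%E]pU adde0.
move=> le0; apply/eqP; rewrite -measure_le0; apply: le_trans le0.
apply: le_measure; rewrite ?inE; first exact: measurable_ray.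
  by apply: measurableU => //; exact: measurable_ray.
move=> u /=; rewrite !in_itv/= => ue.
have [uA|uA] := ltP u (sup A - e / 2); [by left|right; apply: eU].
by rewrite /ball/= ltr_norml; apply/andP; split; lra.
Qed.

End SupportBottom.

(** * The spectral representation *)

Section Spectral.
Context (R : realType) (psi : probability (measurableTypeR R) R).
Local Notation D := (`[0%R, +oo[%classic : set (measurableTypeR R)).

(** Integrability is carried along with the value, since the value alone does
    not support linearity. *)
Definition has_integral (f : R -> R) (a : R) : Prop :=
  psi.-integrable D (EFin \o f) /\ Rintegral psi D f = a.

Lemma measurable_D : measurable D.
Proof. exact: measurable_itv. Qed.
#[local] Hint Resolve measurable_D : core.

Lemma has_integral_ext f g a : (forall x, f x = g x) ->
  has_integral f a -> has_integral g a.
Proof. by move=> /funext ->. Qed.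

Lemma has_integralD f g a c : has_integral f a -> has_integral g c ->
  has_integral (fun x => f x + g x) (a + c).
Proof.
move=> [If <-] [Ig <-]; split; last exact: RintegralD.
exact: (integrableD measurable_D If Ig).
Qed.

Lemma has_integralZ f a c : has_integral f a ->
  has_integral (fun x => c * f x) (c * a).
Proof.
move=> [If <-]; split; last exact: RintegralZl.
exact: (integrableZl measurable_D c If).
Qed.

Lemma has_integral_ge0 f a t : psi `]-oo, t[%classic = 0%E ->
  (forall x, t <= x -> 0 <= f x) -> has_integral f a -> 0 <= a.
Proof.
move=> pt f0 [If <-]; rewrite /Rintegral.
rewrite (negligible_integral (measurable_ray t) measurable_D If pt).
apply/fine_ge0/integral_ge0 => x /= [_]; rewrite in_itv/= => /negP.
by rewrite -leNgt lee_fin => /f0.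
Qed.

Context (w : nat -> R) (w_gt0 : forall k, 0 < w k.+1).
Context (beta C : R) (b : nat -> R).
Context (beta_gt0 : 0 < beta) (b_gt0 : forall k, 0 < b k).
Context (b_le : forall k, b k <= C).
Context (wS : forall k, beta * w k.+2 = b k.+1 * w k.+1).
Local Notation J := (jacobi beta b).
Context (Q : nat -> R -> R).
Context (mQ : forall i, measurable_fun [set: measurableTypeR R]
  (Q i : measurableTypeR R -> R)).
Context (Q0 : forall u, Q 0 u = 0) (Q1 : forall u, Q 1 u = 1).
Context (Q_rec : forall n u, - u * Q n.+1 u =
  beta * Q n u - (b n.+1 + beta) * Q n.+1 u + b n.+1 * Q n.+2 u).
Context (psi_D : psi D = 1%E).
Context (Q_norm : forall i, (0 < i)%N ->
  (\int[psi]_(x in D) ((Q i x) ^+ 2)%:E)%E = ((w i)^-1)%:E).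
Context (Q_orth : forall i j, (0 < i)%N -> (0 < j)%N -> i != j ->
  (\int[psi]_(x in D) (Q i x * Q j x)%:E)%E = 0%E).

(** The products [Q_i Q_j] are integrable because they are dominated by
    [Q_i^2 + Q_j^2]. *)
Lemma QQ_integral i j : has_integral (fun u => Q i.+1 u * Q j.+1 u)
  (if i == j then (w i.+1)^-1 else 0).
Proof.
have mQQ k l : measurable_fun D (fun u => Q k u * Q l u).
  by apply: measurable_funTS; apply: measurable_funM; exact: mQ.
have sq k : psi.-integrable D (EFin \o (fun u => Q k.+1 u ^+ 2)).
  apply/integrableP; split; first by apply/measurable_EFinP; exact: mQQ.
  rewrite [X in (X < _)%E](_ : _ = ((w k.+1)^-1)%:E) ?ltry// -Q_norm//.
  by apply: eq_integral => u _ /=; rewrite ger0_norm// sqr_ge0.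
split; last first.
  rewrite /Rintegral; case: eqP => [->|/eqP ij]; last by rewrite Q_orth.
  by rewrite (_ : (w j.+1)^-1 = fine ((w j.+1)^-1)%:E)// -Q_norm.
apply: (@le_integrable _ _ _ _ _ measurable_D _
  (EFin \o (fun u => Q i.+1 u ^+ 2 + Q j.+1 u ^+ 2))).
- by apply/measurable_EFinP; exact: mQQ.
- move=> u _ /=; rewrite lee_fin [leRHS]ger0_norm ?addr_ge0 ?sqr_ge0// normrM.
  have := sqr_ge0 (`|Q i.+1 u| - `|Q j.+1 u|).
  rewrite sqrrB !real_normK ?num_real//.
  have := sqr_ge0 (Q i.+1 u); have := sqr_ge0 (Q j.+1 u); lra.
- exact: (integrableD measurable_D (sq i) (sq j)).
Qed.

(** Truncating the expansion, rather than the sequence, lets the identities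
    below hold for arbitrary sequences, with explicit boundary terms. *)
Definition expand (x : nat -> R) n u := \sum_(k < n) x k.+1 * Q k.+1 u.

Lemma expandS x n u : expand x n.+1 u = expand x n u + x n.+1 * Q n.+1 u.
Proof. by rewrite /expand big_ord_recr. Qed.

Lemma expand0 x u : expand x 0 u = 0.
Proof. by rewrite /expand big_ord0. Qed.

Lemma has_integral0 : has_integral (fun=> 0) 0.
Proof.
have := has_integralZ 0 (QQ_integral 0 0); rewrite mul0r.
by apply: has_integral_ext => u; rewrite mul0r.
Qed.

Lemma expand_Q_integral x n j : has_integral (fun u => expand x n u * Q j.+1 u)
  (if (j < n)%N then x j.+1 / w j.+1 else 0).
Proof.
elim: n => [|n IH].
  by apply: has_integral_ext has_integral0 => u; rewrite expand0 mul0r.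
have -> : (if (j < n.+1)%N then x j.+1 / w j.+1 else 0) =
    (if (j < n)%N then x j.+1 / w j.+1 else 0) +
    x n.+1 * (if n == j then (w n.+1)^-1 else 0).
  have [<-|nj] := eqVneq n j; first by rewrite ltnn ltnSn add0r.
  by rewrite mulr0 addr0 ltnS leq_eqVlt (eq_sym j) (negbTE nj).
apply: has_integral_ext (has_integralD IH (has_integralZ _ (QQ_integral n j))).
by move=> u; rewrite expandS mulrDl mulrA.
Qed.

Lemma expand_integral x y n : has_integral (fun u => expand x n u * expand y n u)
  (pdot w x y n).
Proof.
suff H m : (m <= n)%N ->
    has_integral (fun u => expand x n u * expand y m u) (pdot w x y m) by exact: H.
elim: m => [_|m IH mn].
  rewrite pdot0; apply: has_integral_ext has_integral0 => u.
  by rewrite expand0 mulr0.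
have := has_integralD (IH (ltnW mn))
  (has_integralZ (y m.+1) (expand_Q_integral x n m)).
rewrite mn pdotS mulrCA mulrA; apply: has_integral_ext => u.
by rewrite expandS mulrDr mulrCA.
Qed.

(** Summation by parts in the three-term recurrence: the expansion turns the
    multiplication by [- u] into [J], apart from the truncation at [n]. *)
Lemma expand_mulX x n u : x 0%N = 0 -> - u * expand x n u =
  expand (J x) n u + b n * x n * Q n.+1 u - beta * x n.+1 * Q n u.
Proof.
move=> x0; elim: n => [|n IH].
  by rewrite !expand0 Q0 x0; ring.
rewrite !expandS mulrDr IH mulrCA Q_rec [J x n.+1]/=; ring.
Qed.

Lemma quadratic_form_integral x n : x 0%N = 0 ->
  has_integral (fun u => - u * (expand x n u * expand x n u))
    (pdot w (J x) x n - b n / w n.+1 * (x n.+1 * x n)).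
Proof.
move=> x0; case: n => [|n].
  rewrite pdot0 x0 !mulr0 subr0; apply: has_integral_ext has_integral0 => u.
  by rewrite expand0 !mulr0.
have I1 := expand_integral (J x) x n.+1.
have I2 := has_integralZ (b n.+1 * x n.+1) (expand_Q_integral x n.+1 n.+1).
have I3 := has_integralZ (- beta * x n.+2) (expand_Q_integral x n.+1 n).
have := has_integralD (has_integralD I1 I2) I3.
rewrite ltnn ltnSn mulr0 addr0.
rewrite (_ : - beta * x n.+2 * (x n.+1 / w n.+1)
    = - (b n.+1 / w n.+2 * (x n.+2 * x n.+1))); last first.
  by rewrite (edge_weight w_gt0 wS); ring.
by apply: has_integral_ext => u; rewrite [RHS]mulrA (expand_mulX _ _ x0); ring.
Qed.

Lemma form_lower_bound_finite t x n : psi `]-oo, t[%classic = 0%E -> x 0%N = 0 ->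
  t * pdot w x x n <= - pdot w (J x) x n + b n / w n.+1 * (x n.+1 * x n).
Proof.
move=> pt x0; rewrite -subr_ge0.
have I1 := has_integralD (has_integralZ (- 1) (quadratic_form_integral n x0))
  (has_integralZ (- t) (expand_integral x x n)).
suff : 0 <= - 1 * (pdot w (J x) x n - b n / w n.+1 * (x n.+1 * x n))
    + - t * pdot w x x n by lra.
apply: (has_integral_ge0 pt _ I1) => u tu.
rewrite (_ : _ + _ = (u - t) * expand x n u ^+ 2); last by ring.
by rewrite mulr_ge0 ?sqr_ge0 ?subr_ge0.
Qed.

(** Integrate [(u - t) (expand x n)^2], nonnegative where [psi] lives, and let
    the truncation tend to infinity. *)
Lemma form_lower_bound t x : psi `]-oo, t[%classic = 0%E ->
  L2 w x -> L2 w (J x) -> L2dot w (J x) x <= - t * L2norm w x ^+ 2.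
Proof.
move=> pt Lx LJx; have [x0 _] := Lx.
have c1 : (fun n => - t * pdot w x x n + b n / w n.+1 * (x n.+1 * x n)) @ \oo -->
    - t * L2norm w x ^+ 2 + 0.
  apply: cvgD; last exact: (boundary_cvg0 w_gt0 b_gt0 b_le wS Lx Lx).
  by apply: cvgMl_tmp; rewrite -L2dotxx//; exact: cvg_pdot.
rewrite addr0 in c1; apply: (ler_cvg_to (cvg_pdot w_gt0 LJx Lx) c1).
by near=> n; have := form_lower_bound_finite n pt x0; lra.
Unshelve. all: by end_near. Qed.

(** The weight itself is a test function: [J w] vanishes except at the first
    site, where it is [- beta w_1], and truncation at [n] adds [beta w_(n+1)].
    So [t (w_1 + ... + w_n) <= beta (w_1 + w_(n+1))], and [w_(n+1) <= w_n] once
    [b_n <= beta]. *)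
Lemma null_ray_le_beta t N : psi `]-oo, t[%classic = 0%E ->
  b N.+2 <= beta -> t <= beta.
Proof.
move=> pt bN; have [t0|t0] := leP t 0; first by rewrite (le_trans t0)// ltW.
pose x k := if k is j.+1 then w j.+1 else 0 : R.
have Jx n : pdot w (J x) x n.+1 = - (beta * w 1).
  elim: n => [|n IH].
    rewrite pdotS pdot0 add0r /= wS; field; by rewrite gt_eqF.
  rewrite pdotS IH /= wS (_ : _ - _ + _ = 0) ?mul0r ?addr0//.
  rewrite -wS; ring.
have xx n : w 1 + w n.+2 <= pdot w x x n.+2.
  have e k : x k.+1 * x k.+1 / w k.+1 = w k.+1 by rewrite /= mulfK// gt_eqF.
  elim: n => [|n IH]; first by rewrite !pdotS pdot0 add0r !e.
  by rewrite pdotS e lerD2r (le_trans _ IH)// lerDl ltW.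
have := form_lower_bound_finite N.+2 pt (erefl : x 0%N = 0).
rewrite Jx opprK /= => H.
have {}H : t * (w 1 + w N.+2) <= beta * (w 1 + w N.+2).
  apply: le_trans (ler_wpM2l (ltW t0) (xx N)) _; apply: le_trans H _.
  rewrite mulrDr lerD2l [X in X <= _](_ : _ = b N.+2 * w N.+2); last first.
    by field; rewrite gt_eqF.
  by rewrite ler_pM2r.
by rewrite -(ler_pM2r (_ : 0 < w 1 + w N.+2))// addr_gt0.
Qed.

Section LowerEdge.
Context (h : nat -> R) (M theta : R).
Context (h_gt0 : forall k, 0 < h k) (M_ge : forall k, b k.+1 + beta <= M).
Context (h_super : forall k,
  b k * h k + (M - (b k.+1 + beta)) * h k.+1 + beta * h k.+2 <= theta * h k.+1).

Let B x := M *: x + J x.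
Let e1 : nat -> R := fun k => (k == 1%N)%:R.

(** Powers of [B] spread the support by one site each, so a longer expansion
    sees no truncation. *)
Lemma iter_support n k : (n.+1 < k)%N -> iter n B e1 k = 0.
Proof.
elim: n k => [|n IH] [|[|k]]//= nk.
have i1 : iter n B e1 k.+1 = 0 by exact: IH.
have i2 : iter n B e1 k.+2 = 0 by apply: IH; exact: ltnW.
have i3 : iter n B e1 k.+3 = 0 by apply: IH; do 2 apply: ltnW.
by rewrite /B seqDE seqZE /= i1 i2 i3; ring.
Qed.

Lemma iter_at0 n : iter n B e1 0%N = 0.
Proof. by elim: n => //= n IH; rewrite /B seqDE seqZE IH /=; ring. Qed.

Lemma expand_iter n N u : (n < N)%N -> expand (iter n B e1) N u = (M - u) ^+ n.
Proof.
elim: n => [|n IH] nN.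
  case: N nN => // N _; elim: N => [|N IH].
    by rewrite expandS expand0 /e1/= Q1; ring.
  by rewrite expandS IH /e1/= mul0r addr0.
have expandD x y : expand (M *: x + y) N u = M * expand x N u + expand y N u.
  rewrite /expand mulr_sumr -big_split/=; apply: eq_bigr => k _.
  by rewrite seqDE seqZE; ring.
rewrite /= {1}/B expandD exprS -IH ?(ltnW nN)// mulrBl -(mulNr u).
rewrite (expand_mulX _ _ (iter_at0 n)) (iter_support nN).
rewrite (iter_support (ltnW nN : (n.+1 < N.+1)%N)).
ring.
Qed.

Lemma iter_norm_le n N :
  pdot w (iter n B e1) (iter n B e1) N <= theta ^+ n ^+ 2 / w 1.
Proof.
elim: n N => [|n IH] N.
  rewrite expr0 expr1n mul1r; case: N => [|N].
    by rewrite pdot0 invr_ge0 ltW.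
  elim: N => [|N IH]; first by rewrite pdotS pdot0 /e1/= add0r !mul1r.
  by rewrite pdotS /e1/= mul0r mul0r addr0.
apply: (le_trans (schur_le w_gt0 beta_gt0 b_gt0 wS h_gt0 M_ge h_super N
  (iter_at0 n))).
by rewrite (exprS theta n) exprMn -[leRHS]mulrA ler_wpM2l ?sqr_ge0.
Qed.

Lemma power_integral n : has_integral (fun u => (M - u) ^+ n * (M - u) ^+ n)
  (pdot w (iter n B e1) (iter n B e1) n.+1).
Proof.
apply: has_integral_ext (expand_integral _ _ _) => u.
by rewrite expand_iter.
Qed.

(** Chebyshev's inequality for the moment of order [2n] of [M - u], which is at
    most [theta^(2n) / w_1]: the mass of [u < t] is bounded by a geometric
    sequence of ratio [(theta / (M - t))^2]. *)
Lemma null_ray t : 0 < theta -> theta < M - t -> psi `]-oo, t[%classic = 0%E.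
Proof.
move=> th0 tM; set S := `]-oo, t[%classic.
have mS : measurable (S : set (measurableTypeR R)) by exact: measurable_itv.
have mSD : measurable (S `&` D) by exact: measurableI.
have psiND : psi (~` D) = 0%E.
  by rewrite probability_setC// psi_D subee.
suff SD : psi (S `&` D) = 0%E.
  have : (psi ((S `&` D) `|` ~` D) <= 0)%E.
    rewrite (le_trans (measureU2 _ _ _))//; first exact: measurableC.
    by rewrite [X in (X + _)%E]SD [X in (_ + X)%E]psiND adde0.
  move=> le0; apply/eqP; rewrite -measure_le0; apply: le_trans le0.
  apply: le_measure; rewrite ?inE//.
    by apply: measurableU => //; exact: measurableC.
  by move=> u Su; have [Du|Du] := pselect (D u); [left|right].
have c0 : 0 < M - t by exact: lt_trans tM.
have pw n : fine (psi (S `&` D)) * ((M - t) ^+ n) ^+ 2 <= theta ^+ n ^+ 2 / w 1.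
  apply: le_trans (iter_norm_le n n.+1).
  have [IB <-] := power_integral n.
  rewrite /Rintegral mulrC -[X in X * _]/(fine (((M - t) ^+ n) ^+ 2)%:E).
  have fS : psi (S `&` D) \is a fin_num by rewrite fin_num_measure.
  rewrite -fineM// fine_le ?integrable_fin_num//; first by rewrite fin_numM.
  rewrite -integral_cst//.
  apply: (@le_trans _ _
    (\int[psi]_(u in S `&` D) ((M - u) ^+ n * (M - u) ^+ n)%:E)%E).
    apply: ge0_le_integral => //.
    - by move=> u _; rewrite lee_fin sqr_ge0.
    - apply: (measurable_funS measurable_D); first exact: subIsetr.
      exact: measurable_int IB.
    - move=> u [Su _]; rewrite lee_fin -expr2 lerXn2r ?nnegrE ?exprn_ge0 ?(ltW c0)//.
        move: Su; rewrite /S/= in_itv/= => ut; rewrite subr_ge0.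
        by rewrite (le_trans (ltW ut))// -subr_ge0 ltW.
      apply: lerXn2r; rewrite ?nnegrE ?(ltW c0)//.
        move: Su; rewrite /S/= in_itv/= => ut; rewrite subr_ge0.
        by rewrite (le_trans (ltW ut))// -subr_ge0 ltW.
      by move: Su; rewrite /S/= in_itv/= lerD2l lerN2; exact: ltW.
  apply: ge0_subset_integral => //.
  - exact: measurable_int IB.
  - by move=> u _; rewrite lee_fin -expr2 sqr_ge0.
pose q := (theta / (M - t)) ^+ 2.
have q1 : `|q| < 1.
  rewrite ger0_norm ?sqr_ge0// expr_lt1// ?ltr_pdivrMr ?mul1r//.
  by rewrite divr_ge0// ltW.
have pq n : fine (psi (S `&` D)) <= geometric (w 1)^-1 q n.
  rewrite /geometric/= -(ler_pM2r (_ : 0 < ((M - t) ^+ n) ^+ 2)) ?exprn_gt0//.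
  apply: le_trans (pw n) _.
  rewrite le_eqVlt; apply/orP; left; apply/eqP.
  have -> : q ^+ n = (theta ^+ n / (M - t) ^+ n) ^+ 2.
    by rewrite /q -expr_div_n -exprM mulnC exprM.
  have := gt_eqF (exprn_gt0 n c0); move: (theta ^+ n) ((M - t) ^+ n) => A E E0.
  by field; rewrite E0 gt_eqF.
have p0 : fine (psi (S `&` D)) <= 0.
  have := cvg_geometric (w 1)^-1 q1 => /(ler_cvg_to (cvg_cst _)); apply.
  by near=> n; exact: pq.
have fS : psi (S `&` D) \is a fin_num by rewrite fin_num_measure.
apply/eqP; rewrite -measure_le0; apply: (@le_trans _ _ (fine (psi (S `&` D)))%:E).
  by rewrite fineK.
by rewrite lee_fin.
Unshelve. all: by end_near. Qed.
End LowerEdge.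

End Spectral.

(** * The rates of the statement and the conclusion *)

Section Rates.
Context (R : realType) (beta rho : R) (L : nat).
Context (beta_gt0 : 0 < beta) (rho_gt0 : 0 < rho) (rho_lt1 : rho < 1).
Context (L_gt0 : (0 < L)%N).

Definition birth k : R := beta * L%:R * rho ^+ (L ^ k).

Lemma birth_gt0 k : 0 < birth k.
Proof. by rewrite /birth !mulr_gt0 ?ltr0n ?exprn_gt0. Qed.

Lemma birth_le k : birth k <= beta * L%:R.
Proof.
by rewrite /birth ler_piMr ?mulr_ge0 ?(ltW beta_gt0)// exprn_ile1 ?ltW.
Qed.

Lemma weight_gt0 k : 0 < weight rho L k.
Proof. by rewrite /weight mulr_gt0 ?exprn_gt0 ?ltr0n. Qed.

Lemma weightS k : beta * weight rho L k.+2 = birth k.+1 * weight rho L k.+1.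
Proof. by rewrite /weight /birth/= big_nat_recr//= exprD exprS; ring. Qed.

(** For [L = 1] the rates are constantly [rho beta]; for [L >= 2] they tend to
    [0]. *)
Lemma birth_small : exists2 q, 0 <= q < 1 &
  exists N, forall k, (N <= k)%N -> birth k <= q * beta.
Proof.
have [L1|L2] := leqP L 1.
  have LE : L = 1%N by apply/eqP; rewrite eqn_leq L1.
  exists rho; first by rewrite ltW.
  by exists 0%N => k _; rewrite /birth LE exp1n mulr1 mulrC.
exists (1 / 2); first by lra.
have rho1 : `|rho| < 1 by rewrite gtr0_norm.
have := cvg_geometric (L%:R : R) rho1 => /cvgrPdist_lt/(_ (1/2)).
case=> [|N _ HN]; first by lra.
exists N => k Nk; have := HN k Nk; rewrite /geometric/= sub0r normrN.
rewrite gtr0_norm ?mulr_gt0 ?ltr0n ?exprn_gt0// => H.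
rewrite /birth -mulrA mulrC ler_pM2r//; apply: le_trans (ltW H).
rewrite ler_pM2l ?ltr0n//; apply: ler_wiXn2l; [exact: ltW..|].
by apply: ltnW; exact: ltn_expl.
Qed.

End Rates.

Theorem theorem2p5 (R : realType) (alpha beta rho : R) (L : nat)
    (alpha_gt0 : 0 < alpha) (beta_gt0 : 0 < beta)
    (rhoE : rho = alpha / beta) (rho_lt1 : rho < 1) (L_ge1 : (1 <= L)%N) :
  let w := weight rho L in
  let K := opK beta rho L in
  [/\ bounded_op w K,
      selfadjoint_op w K,
      (forall z0, L2 w z0 ->
         exists z : R -> nat -> R,
           [/\ solves_ode w K z, z 0 = z0,
               forall t, 0 <= t -> is_expop w K t z0 (z t)
             & forall z' : R -> nat -> R, solves_ode w K z' -> z' 0 = z0 ->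
                 forall t, 0 <= t -> z' t = z t])
    & forall psi : probability (measurableTypeR R) R,
        spectral_measure beta rho L psi ->
        exists gamma : R,
          [/\ is_least (measure_support psi) gamma, 0 < gamma, gamma <= beta
            & forall z : R -> nat -> R, solves_ode w K z ->
                forall t, 0 <= t ->
                  L2norm w (z t) <= expR (- gamma * t) * L2norm w (z 0)]].
Proof.
move=> w K.
have rho_gt0 : 0 < rho by rewrite rhoE divr_gt0.
pose b := birth beta rho L; pose C := beta * L%:R.
have b_gt0 : forall k, 0 < b k by exact: birth_gt0.
have b_le : forall k, b k <= C by exact: birth_le.
have w_gt0 k : 0 < w k.+1 by exact: weight_gt0.
have wS : forall k, beta * w k.+2 = b k.+1 * w k.+1 by exact: weightS.
have KE : K = jacobi beta b by [].
have betaC : beta <= C by rewrite ler_peMr ?(ltW beta_gt0)// ler1n.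
have [q /andP[q0 q1] [N b_small]] := birth_small beta_gt0 rho_gt0 rho_lt1 L_ge1.
have [h [delta delta0 [h_gt0 h_super]]] :=
  supersolution beta_gt0 b_gt0 b_le betaC q0 q1 b_small.
pose M := C + beta; pose theta := M - delta.
have M_ge k : b k.+1 + beta <= M by rewrite lerD2r.
have theta0 : 0 < theta := supersolution_rate_gt0 beta_gt0 b_gt0 h_gt0 M_ge h_super.
have K_L2 x : L2 w x -> L2 w (K x).
  exact: (L2_jacobi w_gt0 beta_gt0 b_gt0 wS h_gt0 M_ge h_super).
pose m := theta + `|M|.
have m0 : 0 <= m by rewrite addr_ge0// ltW.
have K_bound x : L2 w x -> L2norm w (K x) <= m * L2norm w x.
  exact: (L2norm_jacobi w_gt0 beta_gt0 b_gt0 wS h_gt0 M_ge h_super).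
have K_lin a x y : K (a *: x + y) = a *: K x + K y by exact: jacobi_linear.
split.
- split; first exact: K_L2.
    by move=> a x y _ _; exact: K_lin.
  by exists m; exact: K_bound.
- move=> x y Lx Ly.
  exact: (jacobi_selfadjoint w_gt0 b_gt0 b_le wS Lx Ly (K_L2 _ Lx) (K_L2 _ Ly)).
- move=> z0 Lz0; exists (expflow beta b z0).
  have zS := expflow_ode w_gt0 m0 K_L2 K_bound Lz0.
  have z00 : expflow beta b z0 0 = z0 := expflow0 beta b z0.
  split => //.
    by move=> t _; exact: (expflow_expop w_gt0 m0 K_L2 K_bound Lz0).
  move=> z' zS' z0' t t0; apply: (ode_unique w_gt0 K_L2 K_lin K_bound zS zS') => //.
  by rewrite z0' z00.
move=> psi [psi_D Q_norm Q_orth].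
pose Q i u := (polQ beta rho L i).[u].
have mQ i : measurable_fun [set: measurableTypeR R]
    (Q i : measurableTypeR R -> R).
  by apply: continuous_measurable_fun; exact: continuous_horner.
have Q0 u : Q 0 u = 0 by rewrite /Q horner0.
have Q1 u : Q 1 u = 1 by rewrite /Q hornerC.
have Q_rec n u : - u * Q n.+1 u =
    beta * Q n u - (b n.+1 + beta) * Q n.+1 u + b n.+1 * Q n.+2 u.
  exact: (polQ_rec (n := n.+1)).
have low : psi `]-oo, (delta / 2)[%classic = 0%E.
  apply: (null_ray w_gt0 beta_gt0 b_gt0 wS mQ Q0 Q1 Q_rec psi_D Q_norm Q_orth
    h_gt0 M_ge h_super theta0).
  by rewrite ltrD2l ltrN2 ltr_pdivrMr// ltr_pMr// ltr1n.
have high t : psi `]-oo, t[%classic = 0%E -> t <= beta.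
  move=> pt; apply: (null_ray_le_beta w_gt0 beta_gt0 wS mQ Q0 Q_rec Q_norm
    Q_orth pt (N := N)).
  apply: le_trans (b_small _ _) _; first by rewrite (leq_trans (leqnSn N))// ltnS.
  by rewrite ler_piMl ?ltW.
have [gamma [least g0 gb below]] := exists_spectral_bottom low high.
exists gamma; split => //; first by rewrite (lt_le_trans _ g0)// divr_gt0.
move=> z zS t t0; apply: (energy_decay w_gt0 K_L2 zS) => // x Lx.
(* The absence of mass is known below each [t < gamma] only, so the bound on
   the form at [gamma] itself is obtained up to any [e]. *)
apply/ler_addgt0Pr => e e0.
pose s := L2norm w x ^+ 2; have s0 : 0 <= s by exact: sqr_ge0.
have es : 0 < e / (s + 1) by rewrite divr_gt0// ltr_wpDl.
have pt : psi `]-oo, (gamma - e / (s + 1))[%classic = 0%E.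
  by apply: below; rewrite ltrBlDr ltrDl.
have := form_lower_bound w_gt0 b_gt0 b_le wS mQ Q0 Q_rec Q_norm Q_orth pt Lx
  (K_L2 _ Lx).
move=> /le_trans; apply; rewrite -/s opprB mulrDl addrC mulNr lerD2l.
by rewrite mulrAC ler_pdivrMr ?ltr_wpDl// ler_pM2l// lerDl.
Qed.
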